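(* The connective constant of the hexagonal lattice $\mathbb{H}$ is $$\mu=\sqrt{2+\sqrt{2}}.$$
   Context: The hexagonal (honeycomb) lattice $\mathbb{H}$ is the infinite 3-regular planar graph given by the vertices and edges of the tiling of the plane by regular hexagons. An $n$-step self-avoiding walk on $\mathbb{H}$ is a sequence $(\omega(0),\dots,\omega(n))$ of pairwise distinct vertices of $\mathbb{H}$ with $\omega(j-1)$ and $\omega(j)$ adjacent for $j=1,\dots,n$. Let $c_n$ be the number of $n$-step self-avoiding walks starting from a fixed vertex. The connective constant is $\mu=\lim_{n\to\infty}c_n^{1/n}$; the limit exists because $c_{n+m}\le c_nc_m$. *)

(* Defs.v *)
From mathcomp Require Import all_boot all_order all_algebra finmap.
From mathcomp Require Import ring lra zify.
From mathcomp Require Import all_classical all_reals all_analysis.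
Set Implicit Arguments.
Unset Strict Implicit.
Unset Printing Implicit Defensive.
Import Order.TTheory GRing.Theory Num.Theory.
Import numFieldNormedType.Exports.

Local Open Scope classical_set_scope.
Local Open Scope ring_scope.

(* The honeycomb is bipartite with two vertices per fundamental cell: (a, b, s)
   is the vertex of sublattice s in the cell (a, b) : Z^2.  In the basis of the
   translation lattice chosen for [hex_pos] below, the three edges leave
   (a, b, false) towards (a, b, true), (a - 1, b, true) and (a, b - 1, true). *)
Definition hexv : Type := (int * int * bool)%type.

Definition hex_nbrs (u : hexv) : seq hexv :=
  let: (a, b, s) := u in
  let e : int := if s then 1 else -1 in
  [:: (a, b, ~~ s); (a + e, b, ~~ s); (a, b + e, ~~ s)].

Definition hex_adj : rel hexv := fun u v => v \in hex_nbrs u.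

(* A walk (w(0), ..., w(n)) has n steps, hence n + 1 vertices. *)
Definition saw (v : hexv) (n : nat) : set (n.+1.-tuple hexv) :=
  [set w | [/\ thead w = v, sorted hex_adj w & uniq w]].
Arguments saw : clear implicits.

(* [fset_set] of an infinite set would be empty; see [finite_saw]. *)
Definition saw_count (v : hexv) (n : nat) : nat := #|` fset_set (saw v n)|.

Definition saw_root (R : realType) (v : hexv) (n : nat) : R :=
  (saw_count v n)%:R `^ (n%:R^-1).

(* [lim] has a default value for divergent sequences, so this is meaningful
   only together with [cvgn (saw_root R v)]. *)
Definition connective_constant (R : realType) (v : hexv) : R :=
  limn (saw_root R v).

Lemma hex_adj_sym : symmetric hex_adj.
Proof.
case=> [[a b] s] [[c d] t]; rewrite /hex_adj /hex_nbrs !inE !xpair_eqE.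
by case: s; case: t => /=; rewrite ?andbF //=; lia.
Qed.

Lemma hex_adj_irr : irreflexive hex_adj.
Proof. by case=> [[a b] []]; rewrite /hex_adj /hex_nbrs !inE !xpair_eqE !andbF. Qed.

Lemma hex_nbrs_uniq u : uniq (hex_nbrs u).
Proof. by case: u => [[a b] []]; rewrite /= !inE !xpair_eqE; lia. Qed.

Lemma finite_saw v n : finite_set (saw v n).
Proof.
pose F := fix F n u : seq (seq hexv) := if n is m.+1 then
  flatten [seq [seq u :: p | p <- F m x] | x <- hex_nbrs u] else [:: [:: u]].
have FP : forall p u, path hex_adj u p -> u :: p \in F (size p) u.
  elim=> [|x p IH] u /=; first by rewrite inE.
  move=> /andP[ux xp]; apply/flatten_mapP; exists x => //.
  by apply/map_f/IH.
apply: (@sub_finite_set _ _ (val @^-1` [set` F n v])).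
  move=> w /= [wv ws _]; have := size_tuple w.
  case/tupleP: w wv ws => x p; rewrite theadE => -> /= vp [sp].
  by rewrite -{2}sp; apply: FP.
by apply: finite_preimage; [move=> x y _ _; exact: val_inj | exact: finite_seq].
Qed.

(* Comparison with the tiling of the plane by regular hexagons of side 1: the
   hexagons are centred at the points of a triangular lattice, and [hex_pos]
   maps [hexv] onto their corners and [hex_adj] onto their sides. *)
Section Tiling.
Variable R : rcfType.
Implicit Types (a b : int) (u v : hexv).

Definition hex_centre a b : R * R :=
  (3 / 2 * (a + b)%:~R, Num.sqrt 3 / 2 * (b - a)%:~R).

(* The k-th corner is at angle k * pi / 3 from the centre. *)
Definition hex_corner a b (k : nat) : R * R :=
  hex_centre a b +
  nth 0 [:: (1, 0); (1 / 2, Num.sqrt 3 / 2); (- (1 / 2), Num.sqrt 3 / 2);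
            (-1, 0); (- (1 / 2), - (Num.sqrt 3 / 2));
            (1 / 2, - (Num.sqrt 3 / 2))] (k %% 6).

Definition hex_pos (v : hexv) : R * R :=
  let: (a, b, s) := v in hex_centre a b + (if s then 2 else 1, 0).

Lemma hex_pos_inj : injective hex_pos.
Proof.
have s3 : Num.sqrt 3 != 0 :> R by rewrite sqrtr_eq0 -ltNge.
case=> [[a b] s] [[c d] t] /pair_equal_spec[/= ex ey].
have {}ey : b - a = d - c.
  apply: (@intr_inj R); apply: (@mulfI _ (Num.sqrt 3 / 2)).
    by rewrite mulf_neq0 // invr_eq0 pnatr_eq0.
  by move: ey; rewrite !addr0.
have {}ex : 3 * (a + b) + 2 * (if s then 2 else 1) =
            3 * (c + d) + 2 * (if t then 2 else 1) :> int.
  apply: (@intr_inj R).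
  rewrite !(rmorphD, rmorphM) /=.
  move: ex; rewrite !rmorphD /=; case: s; case: t => /=; lra.
have -> : s = t by case: s ex; case: t => //= ex; lia.
have ex' : a + b = c + d by case: s ex; case: t => /=; lia.
by congr (_, _, _); lia.
Qed.

Definition hex_face a b (k : nat) : hexv :=
  nth (a, b, false) [:: (a, b, false); (a - 1, b, true); (a - 1, b, false);
    (a - 1, b - 1, true); (a, b - 1, false); (a, b - 1, true)] (k %% 6).

Lemma hex_pos_face a b k : hex_pos (hex_face a b k) = hex_corner a b k.
Proof.
rewrite /hex_corner /hex_face; have := ltn_pmod k (isT : (0 < 6)%N).
have pairD (x y z t : R) : (x, y) + (z, t) = (x + z, y + t) by [].
case: (k %% 6)%N => [|[|[|[|[|[|//]]]]]] _ /=;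
  by rewrite !pairD !(rmorphD, rmorphB) /=; congr (_, _); field.
Qed.

Lemma hex_corner_pos (p : R * R) :
  (exists a b k, p = hex_corner a b k) <-> (exists v, p = hex_pos v).
Proof.
split=> [[a [b [k ->]]]|[[[a b] s] ->]].
  by exists (hex_face a b k); rewrite hex_pos_face.
case: s; last by exists a, b, 0%N; rewrite -hex_pos_face.
by exists (a + 1), b, 1%N; rewrite -hex_pos_face /hex_face /= addrK.
Qed.

Lemma hex_adj_side u v : hex_adj u v <-> exists a b k,
  [/\ hex_pos u = hex_corner a b k & hex_pos v = hex_corner a b k.+1] \/
  [/\ hex_pos v = hex_corner a b k & hex_pos u = hex_corner a b k.+1].
Proof.
have adjF a b k : hex_adj (hex_face a b k) (hex_face a b k.+1).
  rewrite /hex_face -[k.+1]addn1 -modnDml.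
  have := ltn_pmod k (isT : (0 < 6)%N).
  by case: (k %% 6)%N => [|[|[|[|[|[|//]]]]]] _ /=;
    rewrite /hex_adj /hex_nbrs !inE !xpair_eqE /=; lia.
split; last first.
  move=> [a [b [k]]]; rewrite -!hex_pos_face.
  by move=> [] [/hex_pos_inj -> /hex_pos_inj ->]; rewrite // hex_adj_sym.
have side a b w : hex_adj (a, b, false) w -> exists a' b' k,
    [/\ (a, b, false) = hex_face a' b' k & w = hex_face a' b' k.+1] \/
    [/\ w = hex_face a' b' k & (a, b, false) = hex_face a' b' k.+1].
  rewrite /hex_adj /hex_nbrs !inE => /or3P[] /eqP -> /=.
  - exists (a + 1), b, 1%N; right; rewrite /hex_face /=.
    by split; congr (_, _, _); lia.
  - by exists a, b, 0%N; left.
  - by exists a, b, 5%N; right.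
case: u v => [[a b] s] [[c d] t] uv.
case: s uv => [|uv]; last first.
  have [a' [b' [k H]]] := side _ _ _ uv; exists a', b', k.
  by case: H => -[-> ->]; rewrite -!hex_pos_face; [left|right].
case: t => [uv|]; first by move: uv; rewrite /hex_adj /hex_nbrs !inE !xpair_eqE !andbF.
rewrite hex_adj_sym => vu.
have [a' [b' [k H]]] := side _ _ _ vu; exists a', b', k.
by case: H => -[-> ->]; rewrite -!hex_pos_face; [right|left].
Qed.

End Tiling.

(* Main.v *)
Require Import Defs.
From mathcomp Require Import all_boot all_order all_algebra.
From mathcomp Require Import finmap zify ring lra.
From mathcomp Require Import all_classical all_reals all_analysis.
Import Order.TTheory GRing.Theory Num.Theory.
Import numFieldNormedType.Exports.
Local Open Scope classical_set_scope.
Local Open Scope ring_scope.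
Set Implicit Arguments.
Unset Strict Implicit.
Unset Printing Implicit Defensive.

(** Put [mu = sqrt (2 + sqrt 2) = 2 * cos (pi / 8)] and [x = mu^-1].  The proof
    is built on the parafermionic observable of Duminil-Copin and Smirnov, used
    here in a real form.  Give a walk the weight [cos (k * pi / 8) * x ^+ n],
    where [n] counts its steps after the first and [k], its winding, is the
    number of its left turns minus that of its right turns.  Because
    [cos ((k + 1) * pi / 8) + cos ((k - 1) * pi / 8) = mu * cos (k * pi / 8)],
    a walk weighs as much as its two continuations by one step ([sum_nexts]).
    A continuation may hit a vertex of the walk and so close a loop.  Running
    through this loop the other way round gives another such continuation; the
    two windings are [k + 4] and [k - 4] for some [k], and the two weights
    cancel ([sum_loops0]).  Hence, for walks confined to a domain, the total
    weight is conserved: the walks still inside after [N] steps and the walks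
    that have left the domain before weigh 1 together
    ([observable_identity]).

    The topological input is that the windings of loops and of exits are forced
    ([winding_loop], [exit_winding]).  It is obtained as in Hopf's proof of
    the theorem of turning tangents: the direction of the secant between two
    vertices of the walk is followed while its ends move one at a time.  The
    vertices of the honeycomb are points of a triangular lattice, so secants are
    vectors of Z^2, and counting how often they cross a fixed ray is a
    finite matter: the count is unchanged across a cell of the lattice
    that does not have the origin as a corner ([cross_cell]).

    Two domains give the two bounds.  In the plane slit along a ray behind the
    starting edge, all exits have winding 4 or 5 up to sign, hence a nonpositive
    weight; so the walks inside weigh at least 1, and [c_(n+1) >= mu ^+ n]
    ([saws_lower]).  In a parallelogram, all exits have a nonnegative
    weight, and the exits through the far side have winding 0; so the bridges of
    a given width weigh at most 1 at [x], and at most [r ^+ T] at [r * x] when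
    the width is [T] ([bridge_sum]).  Cutting walks into bridges of decreasing
    width, as Hammersley and Welsh do, shows that [c_n * (r * x) ^+ n] is
    bounded for every [r < 1] ([saws_upper_crit]).  Taking n-th roots squeezes
    the sequence to [mu]. *)

(** * Crossings of a ray in the triangular lattice *)

Notation pt := (int * int)%type.

(** The coordinates refer to two unit vectors at an angle of 120 degrees.  The
    units are listed counterclockwise, so that the index of a unit is its angle
    in multiples of pi / 3. *)
Definition units : seq pt :=
  [:: (1, 0); (1, 1); (0, 1); (-1, 0); (-1, -1); (0, -1)].

Definition vec (b z : pt) : pt := z - b.

Definition step (z z' : pt) : bool := vec z z' \in units.

Definition ray (u : pt) : bool := (u.2 == 0) && (0 < u.1).

(** For a unit step from [u] to [u'], this is the signed number of crossings of
    the ray, counterclockwise ones being positive.  The ray is counted with the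
    points above it: a step crosses when it joins the ray to a point below. *)
Definition cross (u u' : pt) : int :=
  (ray u' && (u.2 < 0)%R)%:Z - (ray u && (u'.2 < 0)%R)%:Z.

(** The ray is included and the opposite ray is not, in accordance with the
    convention made for crossings. *)
Definition upper (u : pt) : int := (ray u || (0 < u.2)%R)%:Z.

Lemma crossC u u' : cross u u' = - cross u' u.
Proof. by rewrite /cross opprB. Qed.

Lemma unitsP (e : pt) : e \in units ->
  [\/ [\/ e = (1, 0), e = (1, 1) | e = (0, 1)],
      e = (-1, 0), e = (-1, -1) | e = (0, -1)].
Proof.
rewrite !inE => /orP[/eqP|/orP[/eqP|/orP[/eqP|/or3P[/eqP|/eqP|/eqP]]]] ->.
- by constructor 1; constructor 1.
- by constructor 1; constructor 2.
- by constructor 1; constructor 3.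
- by constructor 2.
- by constructor 3.
- by constructor 4.
Qed.

Lemma unitsN e : (- e \in units) = (e \in units).
Proof.
case: e => x y; rewrite !inE !xpair_eqE /=; lia.
Qed.

Lemma cross_left u u' : ~~ ray u -> ~~ ray u' -> cross u u' = 0.
Proof. by move=> /negbTE r1 /negbTE r2; rewrite /cross r1 r2. Qed.

(** A step that does not touch the opposite ray crosses the ray exactly when it
    changes sides of the horizontal axis, so crossings telescope. *)
Lemma cross_right u e : e \in units -> u != 0 -> u + e != 0 ->
  ~~ ray (- u) -> ~~ ray (- (u + e)) ->
  cross u (u + e) = ((0 <= (u + e).2)%R)%:Z - ((0 <= u.2)%R)%:Z.
Proof.
case: u => x y; rewrite /cross /ray !xpair_eqE.
by move=> /unitsP He /=; case: He => [[]|||] -> /=; lia.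
Qed.

(** The corners of a cell on the horizontal axis are at most two steps apart;
    if they lay on both sides of the origin, the origin would be a corner. *)
Lemma cell_side u e f c c' : e \in units -> f \in units ->
  let s := [:: u; u + e; u + f; u + e + f] in
  0 \notin s -> c \in s -> c' \in s -> ray c -> ~~ ray (- c').
Proof.
case: u => x y /unitsP He /unitsP Hf /=; rewrite !inE !negb_or !xpair_eqE /ray.
case: He => [[]|||] ->; case: Hf => [[]|||] -> /= => /and4P[c1 c2 c3 c4].
all: move=> /or4P[] /eqP -> /or4P[] /eqP -> /=; lia.
Qed.


(** Reversing the vectors replaces the ray by the opposite one *)
(** Reversing vectors exchanges the ray with the opposite one.  The two rays
    together bound the upper half-plane, so the crossings of one differ from
    those of the other by a change of side. *)
Lemma cross_opp u e : e \in units -> u != 0 -> u + e != 0 ->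
  cross (- u) (- (u + e)) = cross u (u + e) - upper (u + e) + upper u.
Proof.
case: u => x y; rewrite /cross /upper /ray !xpair_eqE.
by move=> /unitsP He /=; case: He => [[]|||] -> /=; lia.
Qed.

(** Homotopy invariance for one cell of the lattice.  The two steps span no
    further lattice point, so the origin is outside as soon as it is not a
    corner.  By [cell_side] the corners avoid one of the two rays: the crossings
    vanish, or they telescope. *)
Lemma cross_cell u e f : e \in units -> f \in units ->
  u != 0 -> u + e != 0 -> u + f != 0 -> u + e + f != 0 ->
  cross u (u + e) + cross (u + e) (u + e + f) = cross u (u + f) + cross (u + f) (u + e + f).
Proof.
move=> He Hf u0 ue uf uef.
set s := [:: u; u + e; u + f; u + e + f].
have s0 : 0 \notin s by rewrite !inE !negb_or ![0 == _]eq_sym u0 ue uf uef.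
have efC : u + f + e = u + e + f by rewrite addrAC.
have [m1 m2 m3 m4] : [/\ u \in s, u + e \in s, u + f \in s & u + e + f \in s].
  by rewrite !inE !eqxx !orbT.
have [/hasP[c cos8 rc]|/hasPn r] := boolP (has ray s).
  have nr c' : c' \in s -> ~~ ray (- c').
    by move=> c's; apply: (cell_side He Hf s0 cos8 c's rc).
  rewrite (cross_right He u0 ue (nr _ m1) (nr _ m2)).
  rewrite (cross_right Hf ue uef (nr _ m2) (nr _ m4)).
  rewrite (cross_right Hf u0 uf (nr _ m1) (nr _ m3)).
  have := cross_right He uf; rewrite efC => -> //; [|exact: nr|exact: nr].
  by ring.
rewrite (cross_left (r _ m1) (r _ m2)) (cross_left (r _ m2) (r _ m4)).
by rewrite (cross_left (r _ m1) (r _ m3)) (cross_left (r _ m3) (r _ m4)).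
Qed.


Lemma vecN x y : vec y x = - vec x y.
Proof. by rewrite /vec opprB. Qed.

Lemma step_sym : symmetric step.
Proof. by move=> x y; rewrite /step vecN unitsN. Qed.

Lemma vec_eq0 x y : (vec x y == 0) = (x == y).
Proof. by rewrite subr_eq0 eq_sym. Qed.

(** The cell swept by the secants when both of their ends make one step. *)
Lemma cross_square b b' x y : step b b' -> step x y ->
  b != x -> b != y -> b' != x -> b' != y ->
  cross (vec b x) (vec b y) + cross (vec b y) (vec b' y) =
  cross (vec b x) (vec b' x) + cross (vec b' x) (vec b' y).
Proof.
rewrite [step b b']step_sym => bb' xy bx by' b'x b'y.
have E1 : vec b x + vec x y = vec b y by rewrite /vec addrC subrKA.
have E2 z : vec b z + vec b' b = vec b' z by rewrite /vec subrKA.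
have := cross_cell (u := vec b x) xy bb'.
by rewrite E1 !E2 !vec_eq0; apply.
Qed.

(** The secants from [x] and [y] to [b], in place of those from [b]. *)
Lemma cross_flip b x y : step x y -> b != x -> b != y ->
  cross (vec b x) (vec b y) =
  cross (vec x b) (vec y b) - upper (vec y b) + upper (vec x b).
Proof.
move=> xy bx by'.
have E1 : vec x b + - vec x y = vec y b by rewrite /vec opprB subrKA.
have := @cross_opp (vec x b) (- vec x y).
rewrite unitsN E1 -!vecN !vec_eq0 [x == b]eq_sym [y == b]eq_sym; exact.
Qed.

Lemma cross_flip' b x y : step x y -> b != x -> b != y ->
  cross (vec x b) (vec y b) =
  cross (vec b x) (vec b y) - upper (vec b y) + upper (vec b x).
Proof.
move=> xy bx by'.
have E1 : vec b x + vec x y = vec b y by rewrite /vec addrC subrKA.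
by have := @cross_opp (vec b x) (vec x y) xy; rewrite E1 -!vecN !vec_eq0; apply.
Qed.

(** * Turning tangents for lattice paths *)

Fixpoint wind_from (b x : pt) (l : seq pt) : int :=
  if l is y :: l' then cross (vec b x) (vec b y) + wind_from b y l' else 0.

(** Signed number of times that the path crosses the ray issued from [b]. *)
Definition wind (b : pt) (s : seq pt) : int :=
  if s is x :: l then wind_from b x l else 0.

Lemma wind_cons2 b x y l :
  wind b [:: x, y & l] = cross (vec b x) (vec b y) + wind b (y :: l).
Proof. by []. Qed.

Lemma wind_cat b s x t : wind b (s ++ x :: t) = wind b (rcons s x) + wind b (x :: t).
Proof.
elim: s => [|y s IH]; first by rewrite /= add0r.
case: s IH => [|z s] IH; first by rewrite /= addr0.
by rewrite rcons_cons !cat_cons !wind_cons2 -cat_cons IH -rcons_cons addrA.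
Qed.

Lemma wind_rcons2 b s x y :
  wind b (rcons (rcons s x) y) = wind b (rcons s x) + cross (vec b x) (vec b y).
Proof. by rewrite -cats1 cat_rcons wind_cat /= addr0. Qed.

Lemma wind_ray b s : all (fun z => ~~ ray (vec b z)) s -> wind b s = 0.
Proof.
elim: s => [|x [|y l] IH] //; rewrite wind_cons2 [all _ _]/= => /andP[rx ryl].
rewrite IH // addr0 cross_left //.
by case/andP: ryl.
Qed.

(** Summing [cross_square] along the path, all terms but those of its two ends
    cancel. *)
Lemma wind_move b b' x l : step b b' -> path step x l ->
  b \notin x :: l -> b' \notin x :: l ->
  wind b' (x :: l) = wind b (x :: l)
    + cross (vec b (last x l)) (vec b' (last x l)) - cross (vec b x) (vec b' x).
Proof.
move=> bb'; elim: l x => [|y l IH] x; first by rewrite /= add0r subrr.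
move=> /= /andP[xy yl]; rewrite in_cons negb_or => /andP[bx byl].
rewrite in_cons negb_or => /andP[b'x b'yl].
have by' : b != y by move: byl; rewrite in_cons negb_or => /andP[].
have b'y : b' != y by move: b'yl; rewrite in_cons negb_or => /andP[].
have := IH y yl byl b'yl; have := cross_square bb' xy bx by' b'x b'y.
rewrite /=; lia.
Qed.

(** The turn at [v] is decomposed through the secant from [p] to [y], which is
    half way between the two directions. *)
Definition turn_cross (p v y : pt) : int :=
  cross (vec p v) (vec p y) + cross (vec p y) (vec v y).

Fixpoint turn_crossings (s : seq pt) : int :=
  if s is y :: s' then
    (if s' is v :: p :: _ then turn_cross p v y else 0) + turn_crossings s'
  else 0.

Lemma turns_cons3 y v p s :
  turn_crossings [:: y, v, p & s] = turn_cross p v y + turn_crossings [:: v, p & s].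
Proof. by []. Qed.

Lemma turns_cat s x y t :
  turn_crossings (s ++ [:: x, y & t]) =
  turn_crossings (s ++ [:: x; y]) + turn_crossings [:: x, y & t].
Proof.
elim: s => [|z [|w s] IH]; first by rewrite /= !addr0 add0r.
  by rewrite /= !addr0.
case: s IH => [|w' s] IH.
  by rewrite /= !addr0 !addrA.
by move: IH; rewrite !cat_cons !turns_cons3 => ->; rewrite addrA.
Qed.

(** Hopf's argument.  The directions of the steps form the diagonal of the
    triangle of all secants; deforming the diagonal to the two other sides
    replaces the turns by the path seen from its first vertex and the path seen
    from its last one.  Paths are listed from their last vertex [y] to their
    first vertex [b]; the induction removes [y], and [wind_move] compensates for
    the change of viewpoint. *)
Lemma turn_crossings_open y l b : path step y (rcons l b) -> uniq (y :: rcons l b) ->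
  turn_crossings (y :: rcons l b) =
    - wind b (y :: l) - wind y (rcons l b)
    + upper (vec y b) - upper (vec y (head b l)).
Proof.
elim: l y => [|v l IH] y; first by rewrite /=; lia.
move=> yl yu.
have yv : step y v by case/andP: yl.
have vl : path step v (rcons l b) by case/andP: yl.
have vu : uniq (v :: rcons l b) by case/andP: yu.
have yvl : y \notin v :: rcons l b by case/andP: yu.
have vnl : v \notin rcons l b by case/andP: vu.
move/(_ _ vl vu) in IH.
have ynl : y \notin rcons l b by move: yvl; rewrite in_cons negb_or => /andP[].
have yvn : y != v by move: yvl; rewrite in_cons negb_or => /andP[].
have [p [t [E Ep]]] : exists p t, rcons l b = p :: t /\ head b l = p.
  by case: (l) => [|p t]; [exists b, [::]|exists p, (rcons t b)].
have bin : b \in p :: t by rewrite -E mem_rcons mem_head.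
have lastE : last p t = b by move: (last_rcons b l b); rewrite E.
rewrite E in vl vnl ynl vu IH.
have vp : step v p by case/andP: vl.
have pl : path step p t by case/andP: vl.
have neq z c : c \in p :: t -> z \notin p :: t -> (c != z) /\ (z != c).
  move=> ci zi; have cz : c != z by apply: contraNneq zi => <-.
  by rewrite cz eq_sym cz.
have [vb bv] := neq v b bin vnl; have [yb by'] := neq y b bin ynl.
have [vp' pv] := neq v p (mem_head _ _) vnl.
have [yp py] := neq y p (mem_head _ _) ynl.
have vy : step v y by rewrite step_sym.
have pv' : step p v by rewrite step_sym.
have vny : v != y by rewrite eq_sym.
rewrite [rcons _ _]/= E turns_cons3 !wind_cons2 [head _ _]/= {}IH Ep /turn_cross.
rewrite (wind_move vy pl vnl ynl) lastE.
rewrite (cross_flip vy vp' yp) (cross_flip' pv' py yvn) (crossC (vec b y)).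
rewrite (cross_flip vy vb yb) (crossC (vec y v)).
ring.
Qed.

(** For a closed path, the two end terms of [wind_move] are equal. *)
Lemma wind_const x l b bs : path step x l -> last x l = x ->
  path step b bs -> all (fun c => c \notin x :: l) (b :: bs) ->
  wind b (x :: l) = wind (last b bs) (x :: l).
Proof.
move=> xl lx; elim: bs b => [|c bs IH] b //.
move=> /andP[bc cbs] /and3P[bxl cxl H].
have {}IH : wind c (x :: l) = wind (last c bs) (x :: l).
  by apply: IH => //; rewrite /= cxl.
by rewrite [last _ _]/= -IH (wind_move bc xl bxl cxl) lx addrK.
Qed.

(** The same deformation for a path that returns to its first vertex [v].  Both
    sides of the triangle are now the loop seen from [v], which explains the
    factor 2; the corner of the triangle is cut off along the last edge. *)
Lemma turn_crossings_closed v z y l : path step v (rcons [:: z, y & l] v) ->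
  uniq [:: v, z, y & l] ->
  let z1 := last y l in
  turn_crossings (v :: rcons [:: z, y & l] v) = - wind v [:: z, y & l] *+ 2
    + upper (vec z v) - upper (vec v z)
    + cross (vec z z1) (vec v z1) + cross (vec z v) (vec z z1).
Proof.
move=> pv u z1.
have vz : step v z by case/andP: pv.
have zl : path step z (rcons (y :: l) v) by case/andP: pv.
have zy : step z y by case/andP: zl.
have yl : path step y (rcons l v) by case/andP: zl.
have yl' : path step y l by move: yl; rewrite rcons_path => /andP[].
have zv : step z v by rewrite step_sym.
move: u; rewrite cons_uniq in_cons negb_or => /andP[/andP[vnz vyl] u].
have zyl : z \notin y :: l by case/andP: u.
have vny : v != y by move: vyl; rewrite in_cons negb_or => /andP[].
have zny : z != y by move: zyl; rewrite in_cons negb_or => /andP[].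
have u' : uniq (z :: rcons (y :: l) v).
  rewrite cons_uniq mem_rcons rcons_uniq in_cons negb_or eq_sym vnz zyl vyl.
  by case/andP: u.
have ynv : y != v by rewrite eq_sym.
have ynz : y != z by rewrite eq_sym.
have znv : z != v by rewrite eq_sym.
rewrite -[rcons _ _]/[:: z, y & rcons l v] turns_cons3 (turn_crossings_open zl u').
have -> : wind z (rcons (y :: l) v) = wind z (y :: l) + cross (vec z z1) (vec z v).
  by rewrite /z1 lastI wind_rcons2.
have := wind_move zv yl' zyl vyl; rewrite -/z1 wind_cons2 /turn_cross [head _ _]/=.
have yz : step y z by rewrite step_sym.
rewrite (cross_flip zv ynz ynv) (cross_flip' yz vny vnz) (crossC (vec z z1) (vec z v)).
rewrite (crossC (vec v y)) mulr2n => ->; ring.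
Qed.

(** * Windings of honeycomb walks *)

(** The sum of the two coordinates is 0 modulo 3 on the sublattice [false] and 1
    on the sublattice [true]; the remaining points are the centres of hexagons. *)
Definition pos (v : hexv) : pt :=
  let: (a, b, s) := v in (a + 2 * b + (if s then 1 else 0), b - a).

(** The order is that of [hex_nbrs]. *)
Definition dirs (s : bool) : seq pt :=
  if s then [:: (-1, 0); (0, -1); (1, 1)] else [:: (1, 0); (0, 1); (-1, -1)].

Lemma pos_nbrs v : [seq vec (pos v) (pos y) | y <- hex_nbrs v] = dirs v.2.
Proof.
case: v => [[a b] s]; rewrite /vec /=.
have pairB (x y z t : int) : (x, y) - (z, t) = (x - z, y - t) :> pt by [].
by case: s; rewrite /= !pairB; congr [:: (_, _); (_, _); (_, _)]; lia.
Qed.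

Lemma pos_inj : injective pos.
Proof.
move=> [[a b] s] [[c d] t] [] H1 H2.
have st : s = t by case: s t H1 => [] []; lia.
by rewrite st in H1 *; congr (_, _, _); lia.
Qed.

Lemma dirs_units s e : e \in dirs s -> e \in units.
Proof. by case: s; rewrite !inE => /or3P[] /eqP->. Qed.

Lemma adj_dirs u v : hex_adj u v -> vec (pos u) (pos v) \in dirs u.2.
Proof. by move=> uv; rewrite -pos_nbrs; apply: map_f. Qed.

Lemma adj_step u v : hex_adj u v -> step (pos u) (pos v).
Proof. by move=> /adj_dirs; apply: dirs_units. Qed.

Lemma path_step v s : path hex_adj v s -> path step (pos v) (map pos s).
Proof. by rewrite path_map; apply: sub_path => x y; apply: adj_step. Qed.

Definition angle (e : pt) : int := (index e units)%:Z.

(** The difference of the angles, lifted from Z/6 to Z by the crossings. *)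
Definition turn (p v y : pt) : int :=
  angle (vec v y) - angle (vec p v) + 6 * turn_cross p v y.

Lemma vecE v x y : vec x y = vec v y - vec v x.
Proof. by rewrite /vec opprB subrKA. Qed.

Lemma vec0 v : vec v v = 0. Proof. exact: subrr. Qed.

Lemma turn_pm s p v y : vec v p \in dirs s -> vec v y \in dirs s -> p != y ->
  (turn p v y == 1) || (turn p v y == -1).
Proof.
rewrite /turn /turn_cross (vecE v p) (vecE v p y) vec0 sub0r -vec_eq0 (vecE v p).
move: (vec v p) (vec v y) => a b.
case: s; rewrite !inE => /or3P[] /eqP-> /or3P[] /eqP->.
all: by vm_compute.
Qed.

Lemma turn_opp s p v y z : vec v p \in dirs s -> vec v y \in dirs s ->
  vec v z \in dirs s -> p != y -> p != z -> y != z ->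
  turn p v y = - turn p v z.
Proof.
rewrite -(vec_eq0 p y) -(vec_eq0 p z) -(vec_eq0 y z).
rewrite /turn /turn_cross !(vecE v p) (vecE v y z) vec0 sub0r.
move: (vec v p) (vec v y) (vec v z) => a b c.
case: s; rewrite !inE => /or3P[] /eqP-> /or3P[] /eqP-> /or3P[] /eqP-> h1 h2 h3.
all: by apply/eqP; move: h1 h2 h3; vm_compute.
Qed.

(** All walks start with the step [(-1, 0)], whose angle is 3.  Walks are listed
    from their last vertex. *)
Definition winding (w : seq hexv) : int :=
  match map pos w with
  | y :: v :: _ => angle (vec v y) - 3 + 6 * turn_crossings (map pos w)
  | _ => 0
  end.

Lemma winding_cons y v p w :
  winding [:: y, v, p & w] = winding [:: v, p & w] + turn (pos p) (pos v) (pos y).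
Proof. by rewrite /winding /turn !map_cons turns_cons3; cbv iota; ring. Qed.

(** The last hypothesis says that the loop from [v] through [z1] and [z] does not
    wind around [p], where [w] is the contribution of the part from [z] to
    [z1].  It eliminates [w], and what remains depends only on the three
    directions at [v]. *)
Lemma loop_turning_local s p v z z1 w :
  vec v p \in dirs s -> vec v z \in dirs s -> vec v z1 \in dirs s ->
  p != z -> p != z1 -> z != z1 ->
  cross (vec p v) (vec p z) + w + cross (vec p z1) (vec p v) = 0 ->
  angle (vec z v) - angle (vec p v) + 6 * (
    - (w + cross (vec p z1) (vec v z1) - cross (vec p z) (vec v z)) *+ 2
    + upper (vec z v) - upper (vec v z)
    + cross (vec z z1) (vec v z1) + cross (vec z v) (vec z z1) + turn_cross p v z1)
  = 4 * turn p v z.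
Proof.
move=> Hp Hz Hz1 pz pz1 zz1 /eqP; rewrite addrAC addrC addr_eq0 => /eqP ->.
move: Hp Hz Hz1 pz pz1 zz1.
rewrite -(vec_eq0 p z) -(vec_eq0 p z1) -(vec_eq0 z z1).
rewrite /turn /turn_cross !(vecE v p) !(vecE v z) vec0 !sub0r.
move: (vec v p) (vec v z) (vec v z1) => a b c.
case: s; rewrite !inE => /or3P[] /eqP-> /or3P[] /eqP-> /or3P[] /eqP-> h1 h2 h3.
all: by apply/eqP; move: h1 h2 h3; vm_compute.
Qed.

Definition start : hexv := (0, 0, true).
Definition off_ray (z : hexv) : bool := ~~ ray (vec (pos start) (pos z)).

(** A loop closed at [v] does not surround [p]: the initial part of the walk
    leads from [p] to [start] without meeting the loop, and the ray issued from
    [start] does not meet it either.  Hence the loop has [p] on its outside, and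
    the direction in which it is run is decided by the side on which it comes
    back to [v]. *)
Lemma winding_loop v l p g : path hex_adj v (l ++ [:: v, p & g]) ->
  last p g = start -> uniq (l ++ [:: v, p & g]) -> (1 < size l)%N ->
  all off_ray (l ++ [:: v, p & g]) ->
  winding (v :: l ++ [:: v, p & g]) =
  winding [:: v, p & g] + 4 * turn (pos p) (pos v) (pos (head v l)).
Proof.
case: l => [|z [|y l]] // + lw uw _ rw.
set L := [:: z, y & l]; set z1 := last y l => vw.
have [vL vg] : path hex_adj v (rcons L v) /\ path hex_adj v (p :: g).
  by move: vw; rewrite -cat_rcons cat_path last_rcons => /andP[].
have uL : uniq (v :: L).
  move: uw; rewrite cat_uniq => /and3P[uL /norP[vL' _] _].
  by rewrite cons_uniq vL'.
have pL : all (fun c => pos c \notin map pos (v :: rcons L v)) (p :: g).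
  apply/allP => c cg; rewrite (mem_map pos_inj).
  move: uw; rewrite cat_uniq => /and3P[_ h /andP[vg' _]].
  have cL : c \notin L by apply: (hasPn h); rewrite in_cons cg orbT.
  rewrite in_cons mem_rcons in_cons (negbTE cL) orbF orbb.
  by apply: contraNneq vg' => <-.
have [ez ez1] : head v L = z /\ last z (y :: l) = z1 by [].
have L1 : L = rcons (belast z (y :: l)) z1 by rewrite /L [LHS]lastI.
(* The loop is seen from p as from start, that is, it crosses no ray. *)
have wb : wind (pos p) (map pos (v :: rcons L v)) = 0.
  rewrite (@wind_const (pos v) (map pos (rcons L v)) (pos p) (map pos g)).
  - rewrite last_map lw wind_ray // -map_cons all_map.
    apply/allP => c cL; apply: (allP rw).
    have {cL} : (c == v) || (c \in L).
      by move: cL; rewrite in_cons mem_rcons in_cons orbA orbb.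
    by rewrite mem_cat => /orP[/eqP->|->] //; rewrite mem_head orbT.
  - exact: path_step.
  - by rewrite last_map last_rcons.
  - by apply: path_step; case/andP: vg.
  - by rewrite -!map_cons all_map.
have vadj : forall c, hex_adj v c -> vec (pos v) (pos c) \in dirs v.2.
  by move=> c; apply: adj_dirs.
have [vz z1v vp] : [/\ hex_adj v z, hex_adj v z1 & hex_adj v p].
  split; first by case/andP: vL.
    by move: vL; rewrite L1 rcons_path last_rcons hex_adj_sym => /andP[].
  by case/andP: vg.
have z1L : z1 \in L by rewrite L1 mem_rcons mem_head.
have npL c : c \in L -> pos p != pos c.
  move: uw; rewrite cat_uniq => /and3P[_ h _] cL; rewrite (inj_eq pos_inj).
  apply: contraNneq h => pc; apply/hasP; exists c => //.
  by rewrite -pc !inE eqxx orbT.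
have zz1 : pos z != pos z1.
  rewrite (inj_eq pos_inj); move: uL; rewrite cons_uniq => /andP[_].
  by rewrite /L cons_uniq => /andP[+ _]; apply: contraNneq => ->; apply: mem_last.
have [B hLv] : exists B, map pos L = rcons B (pos z1).
  by exists (map pos (belast z (y :: l))); rewrite L1 map_rcons.
have mv : wind (pos v) (map pos L) = wind (pos p) (map pos L)
    + cross (vec (pos p) (pos z1)) (vec (pos v) (pos z1))
    - cross (vec (pos p) (pos z)) (vec (pos v) (pos z)).
  have -> : map pos L = pos z :: map pos (y :: l) by [].
  rewrite (@wind_move (pos p) (pos v)) ?last_map //.
  - by apply: adj_step; rewrite hex_adj_sym.
  - by apply: path_step; move: vL; rewrite rcons_path => /andP[/andP[]].
  - by rewrite -map_cons; apply/mapP => -[c cL] /eqP; apply/negP; apply: npL.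
  - by rewrite -map_cons (mem_map pos_inj); case/andP: uL.
have {}wb : cross (vec (pos p) (pos v)) (vec (pos p) (pos z)) + wind (pos p) (map pos L)
    + cross (vec (pos p) (pos z1)) (vec (pos p) (pos v)) = 0.
  have := wind_rcons2 (pos p) (pos v :: B) (pos z1) (pos v).
  by rewrite !rcons_cons -hLv -map_rcons [LHS]wb => ->.
have E1 : turn_crossings (map pos (v :: L ++ [:: v, p & g])) =
    turn_crossings (map pos (v :: rcons L v)) + turn_cross (pos p) (pos v) (pos z1)
    + turn_crossings (map pos [:: v, p & g]).
  have -> : map pos (v :: L ++ [:: v, p & g]) =
      (pos v :: B) ++ [:: pos z1, pos v & map pos (p :: g)].
    by rewrite map_cons map_cat hLv cat_rcons.
  have -> : map pos (v :: rcons L v) = (pos v :: B) ++ [:: pos z1; pos v].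
    by rewrite map_cons map_rcons hLv -cats1 cat_rcons.
  by rewrite turns_cat addrA.
have E2 : winding (v :: L ++ [:: v, p & g]) = angle (vec (pos z) (pos v)) - 3
    + 6 * turn_crossings (map pos (v :: L ++ [:: v, p & g])) by [].
have E3 : winding [:: v, p & g] = angle (vec (pos p) (pos v)) - 3
    + 6 * turn_crossings (map pos [:: v, p & g]) by [].
have H := @turn_crossings_closed (pos v) (pos z) (pos y) (map pos l).
rewrite -!map_cons -map_rcons last_map -/z1 -/L -map_cons in H.
have -> : head v L = z by [].
have := loop_turning_local (vadj _ vp) (vadj _ vz) (vadj _ z1v)
  (npL _ (mem_head _ _)) (npL _ z1L) zz1 wb.
rewrite -mv => <-; rewrite E2 E1 E3 H; first by ring.
  exact: path_step.
by rewrite (map_inj_uniq pos_inj).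
Qed.

(** * The observable and its conservation law *)

Definition second : hexv := (0, 0, false).

Definition nexts (w : seq hexv) : seq hexv :=
  if w is v :: p :: _ then [seq y <- hex_nbrs v | y != p] else [::].

Lemma adj_rev s : sorted hex_adj (rev s) = sorted hex_adj s.
Proof.
rewrite rev_sorted; case: s => //= x s.
by apply: eq_path => a b; rewrite hex_adj_sym.
Qed.

Section Identity.
Variables (R : realType) (D : pred hexv).
Hypothesis D_second : D second.
Hypothesis D_start : ~~ D start.
Hypothesis D_ray : forall z, D z -> off_ray z.

(** Walks are listed from their last vertex, so that a continuation is a cons. *)
Fixpoint walks_in (n : nat) : seq (seq hexv) :=
  if n is m.+1 then
    [seq y :: w | w <- walks_in m, y <- [seq y <- nexts w | D y && (y \notin w)]]
  else [:: [:: second; start]].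

Definition is_walk_in (w : seq hexv) : bool :=
  [&& sorted hex_adj w, uniq w, suffix [:: second; start] w &
      all (fun z => (z == start) || D z) w].

Lemma is_walk_in_start : is_walk_in [:: second; start].
Proof. by rewrite /is_walk_in suffix_refl /= D_second. Qed.

Lemma mem_walks_in n w : (w \in walks_in n) = (size w == n.+2) && is_walk_in w.
Proof.
elim: n w => [|n IH] w.
  rewrite inE; apply/eqP/andP => [->|[/eqP s2 /and4P[_ _ /suffixP[u E] _]]].
    by split=> //; exact: is_walk_in_start.
  by case: u E s2 => [|a u] -> //=; rewrite size_cat addn2.
apply/allpairsPdep/andP => /=.
  move=> [u [y [uW]]]; rewrite mem_filter => /andP[/andP[Dy yu] yn] ->.
  move: uW; rewrite IH => /andP[/eqP su /and4P[so un sf al]].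
  split; first by rewrite /= su.
  case: u su so un sf al yu yn => [|v [|p u]] //= su so un sf al yu.
  rewrite mem_filter => /andP[yp vy].
  rewrite /is_walk_in /= hex_adj_sym [hex_adj _ _]vy so yu un Dy orbT al andbT.
  rewrite andbT; exact: (suffix_trans sf (suffix_cons _ _)).
move=> [/eqP sw /and4P[so un sf al]].
have [u wE] := suffixP sf.
case: u wE => [|y u] wE; first by rewrite wE in sw.
exists (u ++ [:: second; start]), y.
have Ew : w = y :: (u ++ [:: second; start]) by [].
rewrite Ew in sw so un al *; set t := u ++ _ in sw so un al *.
have tW : t \in walks_in n.
  rewrite IH; move: sw => /= [->]; rewrite eqxx /is_walk_in.
  rewrite (path_sorted so) suffix_suffix.
  by case/andP: un => _ un'; case/andP: al => _ al'; apply/and4P; split.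
case/andP: un => yt _; case/andP: al => yD _.
have Dy : D y.
  case/orP: yD => // /eqP yb; case/negP: yt.
  by rewrite yb mem_cat !inE eqxx !orbT.
split=> //; rewrite mem_filter Dy yt /=.
have : (1 < size t)%N by rewrite size_cat addn2.
case: (t) so yt => [|v [|p t']] //= /and3P[yv vp _] yt _.
rewrite mem_filter; apply/andP; split; last by move: yv; rewrite hex_adj_sym.
by apply: contraNneq yt => ->; rewrite !inE eqxx orbT.
Qed.

Lemma uniq_walks_in n : uniq (walks_in n).
Proof.
elim: n => [|n IH] //=; apply: allpairs_uniq_dep => //.
  by move=> w _; apply: filter_uniq; case: w => [|v [|p w]] //; apply/filter_uniq/hex_nbrs_uniq.
by move=> [w y] [w' y'] _ _ /= [-> ->].
Qed.

Definition cos8 (k : int) : R := cos (k%:~R * (pi / 8)).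

(** This is where [mu] comes from. *)
Lemma cos8_turn k : cos8 (k + 1) + cos8 (k - 1) = 2 * cos (pi / 8) * cos8 k.
Proof.
by rewrite /cos8 rmorphB rmorphD /= mulrBl mulrDl mul1r cosD cosB; ring.
Qed.

(** A difference of 8 in the winding is a half-turn of the phase. *)
Lemma cos8_loop k : cos8 (k + 4) + cos8 (k - 4) = 0.
Proof.
rewrite /cos8 rmorphB rmorphD /= mulrBl mulrDl.
have -> : 4%:~R * (pi / 8) = pi / 2 :> R by field.
by rewrite cosD cosB cos_pihalf; ring.
Qed.

Lemma winding_start : winding [:: second; start] = 0. Proof. by vm_compute. Qed.

Lemma cos8_0 : cos8 0 = 1. Proof. by rewrite /cos8 mul0r cos0. Qed.


Definition loops (n : nat) : seq (seq hexv * hexv) :=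
  [seq (w, y) | w <- walks_in n, y <- [seq y <- nexts w | D y && (y \in w)]].

Lemma loopsP n w y : reflect
  (exists l p g, [/\ w = l ++ [:: y, p & g], (1 < size l)%N,
     y \in nexts w, D y & w \in walks_in n])
  ((w, y) \in loops n).
Proof.
apply: (iffP allpairsPdep) => /=.
  move=> [w' [y' [wW]]]; rewrite mem_filter => /andP[/andP[Dy yw] yn] [-> ->].
  have := wW; rewrite {1}mem_walks_in => /andP[sw /and4P[so un /suffixP[u wE] al]].
  have [i [l wEl]] : exists i l, w' = i ++ y' :: l.
    by case/splitPr: yw => i l; exists i, l.
  case: l wEl => [|p g] wEl.
    have := congr1 (last start) wE; rewrite wEl !last_cat /= => yb.
    by rewrite yb (negbTE D_start) in Dy.
  exists i, p, g; split=> //.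
  move: yn un; rewrite wEl; case: i {wEl} => [|v [|p' i]] //=.
    rewrite mem_filter => /andP[_ h].
    by have := hex_adj_irr y'; rewrite /hex_adj h.
  by rewrite mem_filter eqxx.
move=> [l [p [g [wE _ yn Dy wW]]]]; exists w, y; split; [exact: wW| |by []].
by rewrite mem_filter yn Dy wE mem_cat mem_head orbT.
Qed.

Definition reverse_loop (wy : seq hexv * hexv) : seq hexv * hexv :=
  let: (w, y) := wy in
  (rev (take (index y w) w) ++ drop (index y w) w, y).

Lemma reverse_loopE l y g : y \notin l ->
  reverse_loop (l ++ y :: g, y) = (rev l ++ y :: g, y).
Proof.
move=> yl; rewrite /reverse_loop index_cat (negbTE yl) /= eqxx addn0.
by rewrite take_size_cat // drop_size_cat.
Qed.

(** The reversed loop returns to [y] through the other neighbour, so [winding_loop]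
    applies with the opposite turn. *)
Lemma reverse_loop_spec n w y : (w, y) \in loops n ->
  [/\ reverse_loop (w, y) \in loops n,
      reverse_loop (reverse_loop (w, y)) = (w, y) &
      cos8 (winding (y :: (reverse_loop (w, y)).1)) = - cos8 (winding (y :: w))].
Proof.
move=> wy; have [l [p [g [wE sl yn Dy wW]]]] := loopsP _ _ _ wy.
have := wW; rewrite {1}mem_walks_in => /andP[sw /and4P[so un sf al]].
have ynl : y \notin l.
  move: un; rewrite wE cat_uniq => /and3P[_ h _].
  by apply: contra h => yl; apply/hasP; exists y; rewrite ?mem_head.
have rE := reverse_loopE (p :: g) ynl; rewrite -wE in rE.
have pw : perm_eq (rev l ++ [:: y, p & g]) w.
  by rewrite wE perm_cat2r perm_rev.
have yw : path hex_adj y w.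
  case: (w) yn so => [|v [|q t]] //=.
  by rewrite mem_filter => /andP[_ yv] ->; rewrite hex_adj_sym [hex_adj _ _]yv.
have yrw : path hex_adj y (rev l ++ [:: y, p & g]).
  move: yw; rewrite wE -!(cat_rcons y) !cat_path !last_rcons => /andP[h ->].
  rewrite andbT -rev_cons.
  have : sorted hex_adj (rev (y :: rcons l y)).
    by rewrite adj_rev.
  by rewrite -rcons_cons rev_rcons.
have fW : rev l ++ [:: y, p & g] \in walks_in n.
  rewrite mem_walks_in (perm_size pw) sw /is_walk_in (path_sorted yrw) (perm_uniq pw) un.
  rewrite (perm_all _ pw) al andbT /=.
  have sg : suffix [:: second; start] [:: y, p & g].
    move: sf; rewrite wE !suffixE size_cat /= drop_cat !addnS !subSS !subn0.
    by rewrite ltnNge leq_addr /= addKn.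
  by rewrite (suffix_trans sg (suffix_suffix _ _)).
have fL : reverse_loop (w, y) \in loops n.
  rewrite rE; apply/loopsP; exists (rev l), p, g; rewrite size_rev; split=> //.
  case/lastP: l ynl sl {wE rE pw fW} yrw => [|[|a l] z] //.
  rewrite rev_rcons /= => yl _ /andP[yz _].
  rewrite rev_cons; case E: (rcons (rev l) a) => [|b t]; first by case: (rev l) E.
  rewrite /= mem_filter; rewrite hex_adj_sym in yz; rewrite [y \in _]yz andbT.
  apply: contraNneq yl => ->.
  by rewrite -rcons_cons mem_rcons inE -mem_rev rev_cons E mem_head orbT.
split=> //; first by rewrite rE (reverse_loopE (p :: g)) ?revK ?wE // mem_rev.
have lg : last p g = start.
  have [u Eu] := suffixP sf.
  by have := congr1 (last start) Eu; rewrite wE !last_cat.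
have rayw : all off_ray w.
  apply/allP => c cw; have /orP[/eqP->|] := allP al _ cw; last exact: D_ray.
  by vm_compute.
have E1 : winding (y :: w) =
    winding [:: y, p & g] + 4 * turn (pos p) (pos y) (pos (head y l)).
  by rewrite wE winding_loop // -wE.
have E2 : winding (y :: rev l ++ [:: y, p & g]) =
    winding [:: y, p & g] + 4 * turn (pos p) (pos y) (pos (last y l)).
  rewrite winding_loop ?(perm_uniq pw) ?size_rev ?(perm_all _ pw) //.
  by case/lastP: (l) => [|l' z] //; rewrite rev_rcons last_rcons.
rewrite rE [(_, _).1]/= E1 E2.
have [a [m [b lE]]] : exists a m b, l = a :: rcons m b.
  case: (l) sl => [|a [|c m]] // _.
  by exists a, (belast c m), (last c m); rewrite -lastI.
rewrite lE [head _ _]/= last_cons last_rcons.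
have ulg : uniq (l ++ [:: y, p & g]) by rewrite -wE.
have [ya yb yp] : [/\ hex_adj y a, hex_adj y b & hex_adj y p].
  split; first by move: yw; rewrite wE lE => /andP[].
    move: yrw; rewrite lE rev_cons rev_rcons => /andP[]//.
  by move: yw; rewrite wE cat_path => /andP[_ /and3P[]].
have pl : p \notin l.
  move: ulg; rewrite cat_uniq => /and3P[_ h _]; apply: contra h => pl.
  by apply/hasP; exists p; rewrite // !inE eqxx orbT.
have [pa pb ab] : [/\ p != a, p != b & a != b].
  split; [by apply: contraNneq pl => ->; rewrite lE mem_head| |].
    by apply: contraNneq pl => ->; rewrite lE in_cons mem_rcons mem_head orbT.
  move: ulg; rewrite cat_uniq lE => /andP[/andP[+ _] _].
  by apply: contraNneq => ->; rewrite mem_rcons mem_head.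
rewrite -!(inj_eq pos_inj) in pa pb ab.
have yd c : hex_adj y c -> vec (pos y) (pos c) \in dirs y.2 by apply: adj_dirs.
have -> := turn_opp (yd _ yp) (yd _ ya) (yd _ yb) pa pb ab.
have := turn_pm (yd _ yp) (yd _ yb) pb.
by case/orP => /eqP ->; rewrite ?opprK ?mulrN1 ?mulr1;
  apply/eqP; rewrite -addr_eq0 ?(addrC (cos8 (_ - 4))) cos8_loop.
Qed.

(** Loop reversal is an involution that changes the sign of the weight. *)
Lemma sum_loops0 n : \sum_(wy <- loops n) cos8 (winding (wy.2 :: wy.1)) = 0.
Proof.
have ul : uniq (loops n).
  apply: allpairs_uniq_dep; first exact: uniq_walks_in.
    move=> w _; apply: filter_uniq; case: w => [|v [|p w]] //.
    exact/filter_uniq/hex_nbrs_uniq.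
  by move=> [w y] [w' y'] _ _ /= [-> ->].
have pl : perm_eq (map reverse_loop (loops n)) (loops n).
  apply: uniq_perm => //.
    rewrite map_inj_in_uniq // => -[w y] [w' y'] h h' e.
    have [_ <- _] := reverse_loop_spec h; have [_ <- _] := reverse_loop_spec h'.
    by rewrite e.
  move=> -[w y]; apply/mapP/idP => [[[w' y'] h ->]|h].
    by have [] := reverse_loop_spec h.
  have [h1 h2 _] := reverse_loop_spec h.
  by exists (reverse_loop (w, y)).
set S := \sum_(_ <- _) _.
suff : S = - S by move=> /eqP; rewrite -addr_eq0 -mulr2n mulrn_eq0 => /eqP.
rewrite {1}/S -(perm_big _ pl) /= big_map /S -sumrN big_seq [RHS]big_seq.
apply: eq_bigr => -[w y] h; have [_ _ <-] := reverse_loop_spec h.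
by [].
Qed.

Definition exits (n : nat) : seq (seq hexv * hexv) :=
  [seq (w, y) | w <- walks_in n, y <- [seq y <- nexts w | ~~ D y]].

(** The two continuations make opposite turns of one unit. *)
Lemma sum_nexts n w : w \in walks_in n ->
  \sum_(y <- nexts w) cos8 (winding (y :: w)) = 2 * cos (pi / 8) * cos8 (winding w).
Proof.
rewrite mem_walks_in => /andP[sw /and4P[so un _ _]].
case: w sw so un => [|v [|p w]] // _ /= /andP[vp _] _.
have vd c : c \in hex_nbrs v -> vec (pos v) (pos c) \in dirs v.2.
  exact: adj_dirs.
have [y1 [y2 [yE y12]]] : exists y1 y2,
    [seq y <- hex_nbrs v | y != p] = [:: y1; y2] /\ y1 != y2.
  have s3 : size (hex_nbrs v) = 3 by case: (v) => [[]].
  have := size_rem vp; have := rem_uniq p (hex_nbrs_uniq v).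
  rewrite s3 rem_filter ?hex_nbrs_uniq // -/(filter _ _).
  case: [seq _ <- _ | _] => [|y1 [|y2 []]] //= /andP[+ _] _.
  by rewrite inE => y12; exists y1, y2.
have yin y : y \in [:: y1; y2] -> hex_adj v y /\ pos p != pos y.
  rewrite -yE mem_filter => /andP[yp yv]; split=> //.
  by rewrite (inj_eq pos_inj) eq_sym.
have [v1 p1] := yin y1 (mem_head _ _).
have [v2 p2] := yin y2 (mem_last y1 [:: y2]).
rewrite yE !big_cons big_nil addr0 !winding_cons.
have yy : pos y1 != pos y2 by rewrite (inj_eq pos_inj).
rewrite (turn_opp (vd _ vp) (vd _ v1) (vd _ v2) p1 p2 yy) -cos8_turn.
by have /orP[] := turn_pm (vd _ vp) (vd _ v2) p2 => /eqP ->; rewrite ?opprK // addrC.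
Qed.

Lemma identity_step n :
  2 * cos (pi / 8) * \sum_(w <- walks_in n) cos8 (winding w) =
  \sum_(w <- walks_in n.+1) cos8 (winding w)
  + \sum_(wy <- exits n) cos8 (winding (wy.2 :: wy.1)).
Proof.
have E1 : \sum_(w <- walks_in n.+1) cos8 (winding w) = \sum_(w <- walks_in n)
    \sum_(y <- nexts w | D y && (y \notin w)) cos8 (winding (y :: w)).
  by rewrite big_allpairs_dep; apply: eq_bigr => w _; rewrite big_filter.
have E2 : \sum_(wy <- exits n) cos8 (winding (wy.2 :: wy.1)) = \sum_(w <- walks_in n)
    \sum_(y <- nexts w | ~~ D y) cos8 (winding (y :: w)).
  by rewrite big_allpairs_dep; apply: eq_bigr => w _; rewrite big_filter.
have E3 : 0 = \sum_(w <- walks_in n)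
    \sum_(y <- nexts w | D y && (y \in w)) cos8 (winding (y :: w)).
  rewrite -[LHS](sum_loops0 n) big_allpairs_dep.
  by apply: eq_bigr => w _; rewrite big_filter.
rewrite -[RHS]addr0 [X in _ = _ + X]E3 E1 E2 -!big_split mulr_sumr /=.
rewrite big_seq [RHS]big_seq; apply: eq_bigr => w wW.
rewrite -(sum_nexts wW) (bigID D) /= [X in X + _ = _](bigID (mem w)) /=.
by rewrite -addrA [LHS]addrC.
Qed.

(** Walks are cut off by their number of steps, which loop reversal preserves.
    So the domain may be infinite. *)
Lemma observable_identity N (x : R) : x * (2 * cos (pi / 8)) = 1 ->
  1 = x ^+ N * \sum_(w <- walks_in N) cos8 (winding w) +
    \sum_(n < N) x ^+ n.+1 * \sum_(wy <- exits n) cos8 (winding (wy.2 :: wy.1)).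
Proof.
move=> hx; elim: N => [|N IH].
  by rewrite big_ord0 addr0 mul1r /= big_seq1 winding_start cos8_0.
rewrite {1}IH big_ord_recr /= addrCA addrC; congr (_ + _).
by rewrite -mulrDr -identity_step exprSr -mulrA [x * _]mulrA hx mul1r.
Qed.

End Identity.

(** * Windings at the exits of a domain *)

Section Exits.
Variables (D : pred hexv).
Hypothesis D_second : D second.
Hypothesis D_ray : forall z, D z -> off_ray z.

Lemma walk_off_ray n w : w \in walks_in D n -> all off_ray w.
Proof.
rewrite mem_walks_in // => /andP[_ /and4P[_ _ _ al]].
apply/allP => c cw; have /orP[/eqP->|] := allP al _ cw; last exact: D_ray.
by vm_compute.
Qed.

(** Hopf's formula for the walk prolonged by [y].  Seen from [start], the walk
    crosses the ray at most with its last step, because the domain avoids it. *)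
Lemma exit_winding n w v y : w \in walks_in D n -> head start w = v -> hex_adj v y ->
  y \notin w ->
  winding (y :: w) = angle (vec (pos v) (pos y)) - 3 + 6 *
    (cross (vec (pos start) (pos v)) (vec (pos start) (pos y))
     - wind (pos y) (map pos w)
     + upper (vec (pos y) (pos start)) - upper (vec (pos y) (pos v))).
Proof.
move=> wW hv vy yw; have rw := walk_off_ray wW.
move: wW; rewrite mem_walks_in // => /andP[/eqP sw /and4P[so un /suffixP[u wE] _]].
have [l wl] : exists l, w = v :: rcons l start.
  case: u wE hv {so un yw rw sw} => [|a u] -> /= <-; first by exists [::].
  by exists (rcons u second); rewrite -cats1 cat_rcons.
have sy : path step (pos y) (rcons (map pos (v :: l)) (pos start)).
  rewrite -map_rcons; apply: path_step; rewrite rcons_cons -wl.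
  by move: so; rewrite wl /= hex_adj_sym vy.
have uy : uniq (pos y :: rcons (map pos (v :: l)) (pos start)).
  by rewrite -map_rcons -map_cons (map_inj_uniq pos_inj) rcons_cons -wl /= yw.
have H := turn_crossings_open sy uy.
rewrite -map_rcons rcons_cons -wl in H.
have -> : winding (y :: w) =
    angle (vec (pos v) (pos y)) - 3 + 6 * turn_crossings (pos y :: map pos w).
  by rewrite wl.
rewrite H [head _ _]/= map_cons wind_cons2.
rewrite (wind_ray (s := pos v :: map pos l)) ?(crossC (vec _ (pos y))); first by ring.
by rewrite -map_cons all_map; move: rw; rewrite wl -rcons_cons all_rcons => /andP[].
Qed.

Lemma cross_off_ray u u' : ~~ ray u -> cross u u' = (ray u' && (u.2 < 0)%R)%:Z.
Proof. by rewrite /cross => /negbTE->; rewrite subr0. Qed.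

(** For an exit [y] whose ray to the right is free of the walk. *)
Lemma exit_winding_left n w v y : w \in walks_in D n -> head start w = v -> hex_adj v y ->
  y \notin w -> all (fun z => ~~ ray (vec (pos y) (pos z))) w ->
  winding (y :: w) = angle (vec (pos v) (pos y)) - 3 + 6 *
    (cross (vec (pos start) (pos v)) (vec (pos start) (pos y))
     + upper (vec (pos y) (pos start)) - upper (vec (pos y) (pos v))).
Proof.
move=> wW hv vy yw al; rewrite (exit_winding wW hv vy yw) wind_ray ?subr0 //.
by rewrite all_map.
Qed.

Lemma wind_right b x l : path step x l -> b \notin x :: l ->
  all (fun z => ~~ ray (vec z b)) (x :: l) ->
  wind b (x :: l) = upper (vec b (last x l)) - upper (vec b x).
Proof.
elim: l x => [|y l IH] x; first by rewrite subrr.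
move=> /andP[xy yl]; rewrite in_cons negb_or => /andP[bx byl] /andP[rx ryl].
have by' : b != y by move: byl; rewrite in_cons negb_or => /andP[].
have ry : ~~ ray (vec y b) by case/andP: ryl.
rewrite wind_cons2 (IH y yl byl ryl) [last _ _]/=.
have := cross_flip' xy bx by'; rewrite cross_left // => E.
by rewrite -[LHS]subr0 [X in _ - X]E; ring.
Qed.

(** For an exit [y] whose ray to the left is free of the walk; the crossings of
    the other ray are then changes of side. *)
Lemma exit_winding_right n w v y : w \in walks_in D n -> head start w = v -> hex_adj v y ->
  y \notin w -> all (fun z => ~~ ray (vec (pos z) (pos y))) w ->
  winding (y :: w) = angle (vec (pos v) (pos y)) - 3 + 6 *
    cross (vec (pos start) (pos v)) (vec (pos start) (pos y)).
Proof.
move=> wW hv vy yw al; rewrite (exit_winding wW hv vy yw).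
have -> : wind (pos y) (map pos w) =
    upper (vec (pos y) (pos start)) - upper (vec (pos y) (pos v)).
  move: wW; rewrite mem_walks_in // => /andP[_ /and4P[so un /suffixP[u wE] _]].
  have lw : last start w = start by rewrite wE last_cat.
  case: w {wE} hv lw so al yw {un} => [|v' w]; first by move=> /= <-; rewrite subrr.
  rewrite [head _ _]/= => -> lw so al yw.
  rewrite map_cons wind_right.
  - by rewrite last_map [last v w]lw.
  - exact: path_step.
  - by rewrite -map_cons (mem_map pos_inj).
  - by rewrite -map_cons all_map.
by congr (_ + 6 * _); ring.
Qed.

End Exits.

Lemma nbrP v y : hex_adj v y -> let: (a, b, s) := v in
  let e := vec (pos v) (pos y) in
  if s then [\/ y = (a, b, false) /\ e = (-1, 0),
    y = (a + 1, b, false) /\ e = (0, -1) | y = (a, b + 1, false) /\ e = (1, 1)]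
  else [\/ y = (a, b, true) /\ e = (1, 0),
    y = (a - 1, b, true) /\ e = (0, 1) | y = (a, b - 1, true) /\ e = (-1, -1)].
Proof.
have vE (x z t u : int) : vec (x, z) (t, u) = (t - x, u - z) by [].
case: v => [[a b] []]; rewrite /hex_adj !inE => /or3P[] /eqP-> /=; rewrite vE.
all: by [constructor 1; split=> //; congr pair; lia
  | constructor 2; split=> //; congr pair; lia
  | constructor 3; split=> //; congr pair; lia].
Qed.

(** The tip is not [start], which is the first vertex and occurs only once. *)
Lemma walk_tip (D : pred hexv) n w : D second -> w \in walks_in D n ->
  exists v p t, w = [:: v, p & t] /\ D v.
Proof.
move=> d1; rewrite mem_walks_in // => /andP[/eqP sw /and4P[_ un sf al]].
case: w sw un sf al => [|v [|p w]] // _ un sf al; exists v, p, w; split=> //.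
case/andP: al => /orP[/eqP vb|//] _; case/suffixP: sf => u E.
move: un; rewrite /= -/(uniq (p :: w)); case/andP => /negP[].
have := congr1 (last p) E; rewrite /= last_cat /= vb => <-; exact: mem_last.
Qed.

Lemma walk_head (D : pred hexv) n w y : D second -> w \in walks_in D n -> y \in nexts w ->
  hex_adj (head start w) y /\ D (head start w).
Proof.
move=> d1 wW; have [v [p [t [-> Dv]]]] := walk_tip d1 wW.
by rewrite mem_filter => /andP[_ vy].
Qed.

(** * The slit plane and the lower bound *)

(** The slit consists of the starting vertex and the ray behind it: the first
    step leads away from it. *)
Definition slit_plane (z : hexv) : bool := off_ray z && (z != start).

Lemma slit_second : slit_plane second. Proof. by vm_compute. Qed.
Lemma slit_start : ~~ slit_plane start. Proof. by vm_compute. Qed.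
Lemma slit_ray z : slit_plane z -> off_ray z. Proof. by case/andP. Qed.

Lemma off_rayE a b (s : bool) : off_ray (a, b, s) =
  ~~ ((b == a) && (0 < a)%R).
Proof.
rewrite /off_ray /ray /=; case: s; lia.
Qed.

(** To enter the slit, a walk must have turned around to one of its sides.  The
    edges that end on the slit make an angle of 60 degrees with it, whence the
    two values on each side. *)
Lemma slit_exit n w y : w \in walks_in slit_plane n -> y \in nexts w -> ~~ slit_plane y ->
  y != start -> winding (y :: w) \in [:: 4; 5; -4; -5].
Proof.
move=> wW yn ys yb.
have [] := walk_head slit_second wW yn.
set v := head start w => vy Dv.
have ry : ~~ off_ray y by move: ys; rewrite /slit_plane yb andbT.
have rw := walk_off_ray slit_second slit_ray wW.
have yw : y \notin w.
  by apply: contra ry; apply: (allP rw).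
rewrite (exit_winding_left slit_second slit_ray wW (erefl _) vy yw); last first.
  apply/allP => z zw.
  have := allP rw _ zw.
  move: ry; case: (y) (z) => [[a b] s] [[c d] t]; rewrite /off_ray /ray /=.
  by case: s; case: t; lia.
rewrite -/v cross_off_ray; last by case/andP: Dv.
rewrite (vecN (pos v) (pos y)).
case: v vy Dv => [[a b] s] /nbrP h /andP[Dv _]; move: Dv ry.
by case: s h => -[] [-> ->]; rewrite !off_rayE /ray /upper /ray /angle !inE /=; lia.
Qed.

(** Walks that return to [start] close a polygon around which the tangent turns
    once; the turn at [start] itself is missing. *)
Lemma slit_exit_start n w : w \in walks_in slit_plane n -> start \in nexts w ->
  winding (start :: w) \in [:: 5; -5].
Proof.
move=> wW yn.
have [vy _] := walk_head slit_second wW yn.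
have rw := walk_off_ray slit_second slit_ray wW.
move: wW; rewrite mem_walks_in ?slit_second // => /andP[/eqP sw /and4P[so un /suffixP[u wE] _]].
have {wE} : exists z c l, w = [:: z, c & rcons l start] /\ last c l = second.
  case: u wE sw {so un vy rw} => [|z [|c u]] wE sw.
  - by move: yn; rewrite wE.
  - by exists z, second, [::]; rewrite wE.
  - exists z, c, (rcons u second); split; last by rewrite last_rcons.
    by rewrite wE -cats1 cat_rcons.
move=> [z [c [l [wE lE]]]].
have zb : hex_adj start z by rewrite hex_adj_sym; move: vy; rewrite wE.
have pb : path step (pos start) (rcons (map pos [:: z, c & l]) (pos start)).
  by rewrite -map_rcons; apply: path_step; move: so; rewrite wE /= zb.
have ub : uniq (map pos [:: start, z, c & l]).
  rewrite (map_inj_uniq pos_inj); move: un; rewrite wE -!rcons_cons.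
  by rewrite rcons_uniq.
have H := turn_crossings_closed pb ub; cbv zeta in H.
have -> : winding (start :: w) = angle (vec (pos z) (pos start)) - 3 +
    6 * turn_crossings (pos start :: rcons (map pos [:: z, c & l]) (pos start)).
  by rewrite -map_rcons wE.
rewrite H last_map lE wind_ray; last first.
  rewrite -2!map_cons all_map; apply/allP => d dl; apply: (allP rw).
  by rewrite wE -!rcons_cons mem_rcons inE dl orbT.
have zb1 : z != second.
  apply: contraTneq un => zE.
  by rewrite wE cons_uniq zE -lE -rcons_cons mem_rcons in_cons mem_last orbT.
move: zb1; have /= [] := nbrP zb => -[-> _] //= _; by vm_compute.
Qed.

Section CosSigns.
Variable R : realType.

Lemma cos8N k : cos8 R (- k) = cos8 R k.
Proof. by rewrite /cos8 rmorphN mulNr cosN. Qed.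

(** These are the angles from [- pi / 2] to [pi / 2]. *)
Lemma cos8_ge0 k : -4 <= k <= 4 -> 0 <= cos8 R k.
Proof.
move=> /andP[k1 k2]; apply: cos_ge0_pihalf; have pi0 := pi_gt0 R.
have : -4 <= k%:~R :> R by rewrite (_ : -4 = (-4)%:~R) // ler_int.
have : k%:~R <= 4 :> R by rewrite (_ : 4 = (4 : int)%:~R) // ler_int.
by move=> h1 h2; apply/andP; split; nra.
Qed.

Lemma cos8_slit_le0 k : k \in [:: 4; 5; -4; -5] -> cos8 R k <= 0.
Proof.
have c4 : cos8 R 4 = 0.
  have /eqP := cos8_loop R 0.
  by rewrite add0r sub0r cos8N -mulr2n mulrn_eq0 => /eqP.
have c5 : cos8 R 5 <= 0.
  have /eqP := cos8_loop R 1; rewrite addr_eq0 => /eqP -> ; rewrite oppr_le0.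
  exact: cos8_ge0.
by rewrite !inE => /or4P[] /eqP->; rewrite ?cos8N ?c4.
Qed.

Lemma cos8_le1 k : cos8 R k <= 1. Proof. exact: cos_le1. Qed.

End CosSigns.

Section LowerBound.
Variable R : realType.

(** Exits weigh at most 0, so the weight 1 has to be carried by the walks that
    stay inside, each of which contributes at most [x ^+ N]. *)
Lemma slit_lower_bound N (x : R) : 0 <= x -> x * (2 * cos (pi / 8)) = 1 ->
  1 <= x ^+ N * (size (walks_in slit_plane N))%:R.
Proof.
move=> x0 hx.
rewrite [leLHS](observable_identity slit_second slit_start slit_ray N hx).
rewrite -[leRHS]addr0; apply: lerD.
  rewrite ler_wpM2l ?exprn_ge0 // -sum1_size natr_sum; apply: ler_sum => w _.
  exact: cos8_le1.
apply: sumr_le0 => n _; rewrite mulr_ge0_le0 ?exprn_ge0 // big_seq.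
apply: sumr_le0 => -[w y] /allpairsPdep[w' [y' [wW]]].
rewrite mem_filter => /andP[ny yn] [-> ->]; apply: cos8_slit_le0 => /=.
have [yb|yb] := eqVneq y' start; last exact: slit_exit wW yn ny yb.
rewrite yb in yn *; have := slit_exit_start wW yn.
by rewrite !inE => /orP[] ->; rewrite ?orbT.
Qed.

End LowerBound.

(** * The parallelogram and the weight of bridges *)

(** Projection on the direction of the first step, up to scale: each edge
    changes it by one. *)
Definition column (v : hexv) : int :=
  let: (a, b, s) := v in 2 * (a + b) + (if s then 1 else 0).

(** The starting vertex has column 1, next to the right side; the two slanted
    sides only serve to make the domain finite. *)
Definition parallelogram (T L : nat) (z : hexv) : bool :=
  (1 - 2 * T%:Z <= column z <= 0) && (- L%:Z <= z.1.2 <= L%:Z).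

Section Parallelogram.
Variables (T L : nat).
Hypothesis T0 : (0 < T)%N.
Let D := parallelogram T L.

Lemma parallelogram_second : D second.
Proof. by rewrite /D /parallelogram /=; lia. Qed.

Lemma parallelogram_start : ~~ D start.
Proof. by rewrite /D /parallelogram /=; lia. Qed.

Lemma parallelogram_ray z : D z -> off_ray z.
Proof. by case: z => [[a b] []]; rewrite /D /parallelogram off_rayE /=; lia. Qed.

(** The four sides are crossed with winding 0 (far side), 3 or -3 (side of the
    start), -2 and 1 (slanted sides).  From an exit, one of the two horizontal
    rays leaves the parallelogram at once, which determines the winding. *)
Lemma parallelogram_exit n w y : w \in walks_in D n -> y \in nexts w -> ~~ D y ->
  (-4 <= winding (y :: w) <= 4) &&
  ((column y == - (2 * T%:Z)) ==> (winding (y :: w) == 0)).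
Proof.
move=> wW yn yD.
have [vy Dv] := walk_head parallelogram_second wW yn.
have yb : y != start.
  apply: contraTneq yn => yb; move: vy; rewrite yb hex_adj_sym.
  move: Dv wW; rewrite mem_walks_in ?parallelogram_second //.
  case: w => [|v [|p w]]; rewrite ?andbF // [head _ _]/= => Dv.
  case/andP => _ /and4P[_ un /suffixP[u wE] _].
  rewrite mem_filter => /nbrP /= bv.
  have vE : v = second.
    by move: Dv; case: bv => -[-> _]; rewrite /D /parallelogram /=; [by []|lia|lia].
  case: u wE => [[_ -> _]|a u [_ Ep]]; first by rewrite eqxx.
  by move: un; rewrite cons_uniq vE Ep mem_cat mem_head orbT.
have rw := walk_off_ray parallelogram_second parallelogram_ray wW.
have Dw z : z \in w -> (z == start) || D z.
  move: wW; rewrite mem_walks_in ?parallelogram_second //.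
  by case/andP => _ /and4P[_ _ _ /allP]; apply.
have yw : y \notin w by apply/negP => /Dw; rewrite (negbTE yb) (negbTE yD).
have tL := exit_winding_left parallelogram_second parallelogram_ray wW (erefl _) vy yw.
have tR := exit_winding_right parallelogram_second parallelogram_ray wW (erefl _) vy yw.
have rv : ~~ ray (vec (pos start) (pos (head start w))) by apply: parallelogram_ray.
rewrite cross_off_ray // in tL; rewrite cross_off_ray // in tR.
rewrite (vecN (pos (head start w)) (pos y)) in tL.
move: tL tR; move: (winding _) => t {wW yn rw rv}.
case: (head start w) vy Dv => [[a b] s] /nbrP h Dv tL tR.
have inw (P : pred hexv) : P start -> (forall c d e, D (c, d, e) -> P (c, d, e)) ->
    all P w.
  by move=> Pb PD; apply/allP => -[[c d] e] /Dw /orP[/eqP -> //|]; exact: PD.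
move: h Dv yD yb tL tR; rewrite /= /D /parallelogram /ray.
case: s => -[] [-> ->] /= Dv yD yb tL tR.
- rewrite tR; first by rewrite /angle /=; lia.
  clear tL tR yb; apply: inw => /=; first by lia.
  by move=> c d []; rewrite /D /parallelogram /=; lia.
- by lia.
- rewrite tL; first by rewrite /angle /upper /ray /=; lia.
  clear tL tR yb; apply: inw => /=; first by lia.
  by move=> c d []; rewrite /D /parallelogram /=; lia.
- rewrite tL; first by rewrite /angle /upper /ray /=; lia.
  clear tL tR yb; apply: inw => /=; first by lia.
  by move=> c d []; rewrite /D /parallelogram /=; lia.
- by lia.
- rewrite tR; first by rewrite /angle /=; lia.
  clear tL tR yb; apply: inw => /=; first by lia.
  by move=> c d []; rewrite /D /parallelogram /=; lia.
Qed.


(** A self-avoiding walk is no longer than the number of available vertices. *)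
Lemma walks_in_parallelogram_nil N :
  (4 * (2 * (T + L) + 1) ^ 2 <= N)%N -> walks_in D N = [::].
Proof.
(* All vertices of the domain have both coordinates between - K and K. *)
pose K := (T + L)%N.
pose I := [seq k%:Z - K%:Z | k <- iota 0 (2 * K + 1)].
pose box : seq hexv :=
  [seq (ab, s) | ab <- [seq (a, b) | a <- I, b <- I], s <- [:: true; false]].
have inI a : - K%:Z <= a <= K%:Z -> a \in I.
  move=> aK; apply/mapP; exists (absz (a + K%:Z)); last by lia.
  by rewrite mem_iota; lia.
move=> hN; case E : (walks_in D N) => [|w s] //.
have : w \in walks_in D N by rewrite E mem_head.
rewrite mem_walks_in ?parallelogram_second // => /andP[/eqP sw /and4P[_ un _ /allP al]].
have sub : {subset w <= box}.
  move=> [[a b] s'] /al /orP[/eqP -> |].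
    by apply: allpairs_f; [apply: allpairs_f; apply: inI; lia|rewrite inE].
  rewrite /D /parallelogram /= => h; apply: allpairs_f; last by case: s' {h}.
  by apply: allpairs_f; apply: inI; case: s' h; lia.
have := uniq_leq_size un sub.
by rewrite !size_allpairs /I size_map size_iota sw -/K /=; lia.
Qed.

(** A walk whose tip is in the last column has an exit of winding 0. *)
Lemma parallelogram_exit_sum (R : realType) n :
  (count (fun w => column (head start w) == 1 - 2 * T%:Z) (walks_in D n))%:R <=
  \sum_(wy <- exits D n) cos8 R (winding (wy.2 :: wy.1)).
Proof.
rewrite /exits big_allpairs_dep /= -sum1_count natr_sum big_mkcond /=.
rewrite big_seq [leRHS]big_seq; apply: ler_sum => w wW.
rewrite big_filter.
have ge0 y : y \in nexts w -> ~~ D y -> 0 <= cos8 R (winding (y :: w)).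
  by move=> yn yD; have /andP[h _] := parallelogram_exit wW yn yD; apply: cos8_ge0.
have sum0 s : {subset s <= nexts w} ->
    0 <= \sum_(y <- s | ~~ D y) cos8 R (winding (y :: w)).
  move=> sn; rewrite big_seq_cond; apply: sumr_ge0 => y /andP[ys yD].
  by apply: ge0 => //; apply: sn.
case: eqP => [hc|_]; last exact: sum0.
have [v [p [t [wE Dv]]]] := walk_tip parallelogram_second wW.
pose y : hexv := let: (a, b, s) := v in (a, b, false).
have [vy yD cy yb] : [/\ hex_adj v y, ~~ D y, column y == - (2 * T%:Z) & y != start].
  move: hc Dv; rewrite wE /= /y /D; case: (v) => [[a b] []] /=; last by lia.
  rewrite /parallelogram /= /hex_adj mem_head => hc Dv.
  by split=> //; [lia|lia|rewrite /start xpair_eqE andbF].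
have yn : y \in nexts w.
  rewrite wE /= mem_filter [y \in _]vy andbT.
  move: wW; rewrite mem_walks_in ?parallelogram_second // => /andP[_ /and4P[_ _ _]].
  rewrite wE => /and3P[_ + _]; apply: contraTneq => <-.
  by rewrite (negbTE yb) (negbTE yD).
rewrite (big_rem y yn) /= yD; have /andP[_] := parallelogram_exit wW yn yD.
rewrite cy => /eqP ->; rewrite cos8_0 lerDl; apply: sum0 => z; exact: mem_rem.
Qed.

(** In [observable_identity] no walk remains inside after many steps, and all
    exits have nonnegative weight. *)
Lemma parallelogram_bridge_bound (R : realType) N (x : R) : 0 <= x ->
  x * (2 * cos (pi / 8)) = 1 ->
  \sum_(n < N) x ^+ n.+1 *
    (count (fun w => column (head start w) == 1 - 2 * T%:Z) (walks_in D n))%:R <= 1.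
Proof.
move=> x0 hx; pose M := maxn N (4 * (2 * (T + L) + 1) ^ 2).
have := observable_identity parallelogram_second parallelogram_start parallelogram_ray M hx.
rewrite walks_in_parallelogram_nil ?leq_maxr // big_nil mulr0 add0r => E1; rewrite [leRHS]E1.
pose E n := x ^+ n.+1 * \sum_(wy <- exits D n) cos8 R (winding (wy.2 :: wy.1)).
have E0 n : 0 <= E n.
  rewrite mulr_ge0 ?exprn_ge0 //.
  exact: le_trans (parallelogram_exit_sum _ _).
apply: (@le_trans _ _ (\sum_(n < N) E n)).
  apply: ler_sum => n _; apply: ler_wpM2l; first exact: exprn_ge0.
  exact: parallelogram_exit_sum.
rewrite -(big_mkord xpredT E) -[leRHS](big_mkord xpredT E).
rewrite [leRHS](big_cat_nat _ (leq_maxl _ _)) //=.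
by rewrite lerDl sumr_ge0.
Qed.

End Parallelogram.

(** * Symmetries and enumeration of self-avoiding walks *)

(** Translations, and half-turns, which exchange the two sublattices. *)
Definition symmetry (t : bool) (c : int * int) (z : hexv) : hexv :=
  let: (a, b, s) := z in
  if t then (c.1 - a, c.2 - b, ~~ s) else (c.1 + a, c.2 + b, s).

Lemma symmetry_adj t c z z' : hex_adj (symmetry t c z) (symmetry t c z') = hex_adj z z'.
Proof.
case: z z' => [[a b] s] [[a' b'] s']; rewrite /hex_adj /hex_nbrs /symmetry.
by case: t; case: s; case: s'; rewrite /= !inE !xpair_eqE /= ?andbF //; lia.
Qed.

Lemma symmetry_inj t c : injective (symmetry t c).
Proof.
move=> [[a b] s] [[a' b'] s']; rewrite /symmetry.
by case: t => -[] h1 h2 h3; congr (_, _, _); move: h1 h2 h3; [lia|lia|case: s; case: s'|lia|lia|].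
Qed.

Lemma head_rev (A : Type) (x : A) s : head x (rev s) = last x s.
Proof. by case/lastP: s => [|s y] //; rewrite rev_rcons last_rcons. Qed.

(** The column relative to [u], increasing towards the side on which [u] has two
    neighbours.  With this choice a half-turn preserves heights, and
    both sublattices can be treated alike. *)
Definition height (u v : hexv) : int :=
  if u.2 then column v - column u else column u - column v.

Lemma column_adj u v : hex_adj u v -> `|column v - column u| = 1.
Proof. by case: u => [[a b] s] /nbrP; case: s => -[] [-> _] /=; lia. Qed.

(** The symmetry that brings [u] to the second vertex of the walks considered
    above. *)
Definition normal (u : hexv) : hexv -> hexv :=
  symmetry u.2 (if u.2 then u.1 else - u.1).

Lemma normal_self u : normal u u = second.
Proof. by case: u => [[a b] []]; rewrite /normal /symmetry /= ?subrr ?addNr. Qed.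

Lemma column_normal u z : column (normal u z) = - height u z.
Proof.
by case: u z => [[a b] []] [[c d] []]; rewrite /normal /height /symmetry /=; lia.
Qed.

Definition unnormal (u : hexv) : hexv -> hexv := symmetry u.2 u.1.

Lemma normalK u : cancel (normal u) (unnormal u).
Proof.
move=> [[c d] s]; case: u => [[a b] []]; rewrite /normal /unnormal /symmetry /=.
  by congr (_, _, _); [lia|lia|case: s].
by congr (_, _, _); lia.
Qed.

Fixpoint walks (n : nat) (u : hexv) : seq (seq hexv) :=
  if n is m.+1 then [seq u :: p | x <- hex_nbrs u, p <- walks m x]
  else [:: [:: u]].

Lemma mem_walks n u w : (w \in walks n u) =
  [&& size w == n.+1, head start w == u & sorted hex_adj w].
Proof.
elim: n u w => [|n IH] u w.
  by rewrite inE; case: w => [|v [|v' w]] //=; rewrite ?andbF ?andbT ?eqseq_cons ?andbT ?andbF.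
apply/allpairsPdep/idP => [[x [p [xu pn ->]]]|].
  move: pn; rewrite IH => /and3P[/eqP sp /eqP in_strip so].
  case: p sp in_strip so => [|y p] //= [sp] -> so; rewrite sp !eqxx /= so andbT.
  exact: xu.
case: w => [|v [|x p]] //= /and3P[/eqP[sp] /eqP -> /andP[vx xp]].
by exists x, (x :: p); rewrite IH /= sp !eqxx xp; split.
Qed.

Lemma uniq_walks n u : uniq (walks n u).
Proof.
elim: n u => [|n IH] u //=; apply: allpairs_uniq_dep => //; first exact: hex_nbrs_uniq.
move=> [x p] [y q] /allpairsPdep[x' [p' [_ + [-> ->]]]] /allpairsPdep[y' [q' [_ + [-> ->]]]].
rewrite !mem_walks => /and3P[/eqP sp /eqP in_strip _] /and3P[/eqP sq /eqP hq _] /= [pq].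
by rewrite -in_strip -hq pq.
Qed.

Definition saws (n : nat) (u : hexv) : seq (seq hexv) :=
  [seq w <- walks n u | uniq w].

Definition is_saw (u : hexv) (w : seq hexv) : bool :=
  [&& w != [::], head start w == u, sorted hex_adj w & uniq w].

Lemma mem_saws n u w : (w \in saws n u) = (size w == n.+1) && is_saw u w.
Proof.
rewrite mem_filter mem_walks /is_saw; case: w => //= v w.
by rewrite andbC -!andbA.
Qed.

Definition saws_le (N : nat) (u : hexv) : seq (seq hexv) :=
  [seq w | n <- iota 0 N, w <- saws n u].

Lemma mem_saws_le N u w : (w \in saws_le N u) = (size w <= N)%N && is_saw u w.
Proof.
apply/allpairsPdep/andP => [[n [w' [+ + ->]]]|[sN ws]].
  by rewrite mem_iota mem_saws => /andP[_ nN] /andP[/eqP -> ->].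
exists (size w).-1, w; have w0 : (0 < size w)%N by case: (w) ws.
by rewrite mem_iota mem_saws ws prednK // eqxx.
Qed.

Lemma uniq_saws_le N u : uniq (saws_le N u).
Proof.
apply: allpairs_uniq_dep => //; first exact: iota_uniq.
  by move=> n _; apply/filter_uniq/uniq_walks.
move=> [n p] [m q] /allpairsPdep[n' [p' [_ + [-> ->]]]] /allpairsPdep[m' [q' [_ + [-> ->]]]] /=.
rewrite !mem_saws => /andP[/eqP sp _] /andP[/eqP sq _] pq.
by move: sp; rewrite pq sq => -[->].
Qed.

Lemma lipschitz_path (f : hexv -> int) u p z :
  (forall x y, hex_adj x y -> `|f y - f x| <= 1) ->
  path hex_adj u p -> z \in u :: p -> `|f z - f u| <= (size p)%:Z.
Proof.
move=> fL; elim: p u => [|v p IH] u /=; first by rewrite inE => _ /eqP ->; lia.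
move=> /andP[/fL uv vp]; rewrite inE => /orP[/eqP -> |/(IH _ vp)]; lia.
Qed.

Section Cover.
Variable R : realType.

(** A decomposition of walks is used through this lemma: it suffices that each
    walk can be recovered from some of its pieces. *)
Lemma sum_cover (I J : eqType) (s : seq I) (t : seq J) (f : J -> I)
    (F : I -> R) (G : J -> R) :
  uniq s -> (forall j, j \in t -> 0 <= G j) ->
  (forall i, i \in s -> exists j, [/\ j \in t, f j = i & F i <= G j]) ->
  \sum_(i <- s) F i <= \sum_(j <- t) G j.
Proof.
elim: s t => [|i s IH] t /=; first by move=> _ G0 _; rewrite big_nil big_seq sumr_ge0.
move=> /andP[is_ us] G0 h; have [j [jt fj Fj]] := h i (mem_head _ _).
rewrite big_cons (big_rem j) //= lerD // IH // => [j' /mem_rem|i' i's]; first exact: G0.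
have [j' [j't fj' Fj']] := h i' (mem_behead (s := i :: s) i's).
exists j'; split=> //; move: j't; rewrite (perm_mem (perm_to_rem jt)) inE.
case/orP => // /eqP jj; move: is_; rewrite -fj -jj fj'.
by rewrite i's.
Qed.

End Cover.

(** * Bridges from an arbitrary vertex *)

Definition is_bridge (T : nat) (u : hexv) (b : seq hexv) : bool :=
  all (fun z => 0 <= height u z <= 2 * T%:Z - 1) b &&
  (height u (last u b) == 2 * T%:Z - 1).

Section Bridges.
Variable R : realType.

(** Prepended with [start], the image of a bridge under [normal] is a walk across
    a parallelogram which is high enough for its length. *)
Lemma bridge_sum_crit T N u (x : R) : (0 < T)%N -> 0 <= x ->
  x * (2 * cos (pi / 8)) = 1 ->
  \sum_(b <- saws_le N u | is_bridge T u b) x ^+ size b <= 1.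
Proof.
move=> T0 x0 hx; apply: (le_trans _ (@parallelogram_bridge_bound T N T0 R N x x0 hx)).
rewrite -big_filter.
pose X n := [seq w <- walks_in (parallelogram T N) n | column (head start w) == 1 - 2 * T%:Z].
pose t := [seq (n, w) | n <- index_iota 0 N, w <- X n].
have -> : \sum_(n < N) x ^+ n.+1 * (count (fun w =>
    column (head start w) == 1 - 2 * T%:Z) (walks_in (parallelogram T N) n))%:R =
    \sum_(nw <- t) x ^+ nw.1.+1.
  rewrite -(big_mkord xpredT (fun n => x ^+ n.+1 * (count _ (walks_in _ n))%:R)).
  rewrite big_allpairs_dep; apply: eq_bigr => n _ /=.
  by rewrite big_const_seq count_predT iter_addr addr0 size_filter mulr_natr.
apply: (@sum_cover _ _ _ _ _
  (fun nw => map (unnormal u) (behead (rev nw.2)))).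
- by apply/filter_uniq/uniq_saws_le.
- by move=> nw _; rewrite exprn_ge0.
move=> b; rewrite mem_filter mem_saws_le => /andP[/andP[/allP hb /eqP hl] /andP[sN]].
case: b hb hl sN => [|v p] hb hl sN; first by rewrite /is_saw.
rewrite /is_saw /= => /and3P[/eqP vu up unp].
rewrite {v}vu in hb hl sN unp up *.
have [q qM] : exists q, q = map (normal u) (u :: p) by eexists.
exists (size p, rev (start :: q)); split=> /=.
- apply/allpairsPdep; exists (size p), (rev (start :: q)); split=> //.
    by rewrite mem_index_iota.
  have qE : q = second :: map (normal u) p by rewrite qM /= normal_self.
  have lq : last second (map (normal u) p) = normal u (last u p).
    by rewrite -(normal_self u) last_map.
  rewrite mem_filter; apply/andP; split.
    rewrite head_rev /= qE /= lq column_normal [height _ _]hl; lia.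
  rewrite mem_walks_in ?parallelogram_second // size_rev [size _]/= {1}qM size_map.
  rewrite eqxx /is_walk_in adj_rev rev_uniq.
  rewrite all_rev; apply/and5P; split=> //.
  + have -> : sorted hex_adj (start :: q) = path hex_adj second (map (normal u) p).
      by rewrite qE.
    rewrite -(normal_self u) path_map.
    by rewrite (eq_path (e' := hex_adj)) // => a b; rewrite /= symmetry_adj.
  + rewrite cons_uniq qM (map_inj_uniq (@symmetry_inj _ _)) cons_uniq unp andbT.
    apply/mapP => -[z zp bE]; have /andP[h _] := hb z zp.
    by have := column_normal u z; rewrite -bE; move: h; rewrite /=; lia.
  + by rewrite qE !rev_cons -!cats1 -catA suffix_suffix.
  + rewrite /= qM all_map; apply/allP => z zp /=.
    have /andP[h1 h2] := hb z zp.
    have zL : `|(normal u z).1.2 - (normal u u).1.2| <= (size p)%:Z.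
      apply: (@lipschitz_path (fun z => (normal u z).1.2)) zp => // a b ab.
      have : hex_adj (normal u a) (normal u b) by rewrite symmetry_adj.
      by case: (normal u a) => [[c d] []] /nbrP /= [] [-> _] /=; lia.
    apply/orP; right; rewrite /parallelogram column_normal.
    by move: zL sN; rewrite normal_self /=; lia.
- by rewrite revK qM -map_comp map_id_in // => z _; exact: normalK.
- by [].
Qed.

Lemma bridge_size T u w : is_saw u w -> is_bridge T u w -> (T <= size w)%N.
Proof.
case: w => [|v p] // /and4P[_ /eqP /= -> up _] /andP[_ /eqP /= hl].
have := lipschitz_path (f := column) (z := last u p) _ up (mem_last _ _).
have cL a b : hex_adj a b -> `|column b - column a| <= 1 by move/column_adj => ->.
by move=> /(_ cL); move: hl; rewrite /height; case: ifP => _; lia.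
Qed.

(** A bridge of width [T] has at least [T] vertices, so reducing the parameter
    by the factor [r] gains [r ^+ T]. *)
Lemma bridge_sum T N u (x r : R) : (0 < T)%N -> 0 <= x -> 0 <= r <= 1 ->
  x * (2 * cos (pi / 8)) = 1 ->
  \sum_(b <- saws_le N u | is_bridge T u b) (r * x) ^+ size b <= r ^+ T.
Proof.
move=> T0 x0 /andP[r0 r1] hx.
apply: (@le_trans _ _ (\sum_(b <- saws_le N u | is_bridge T u b) r ^+ T * x ^+ size b)).
  rewrite big_seq_cond [leRHS]big_seq_cond; apply: ler_sum => b.
  rewrite mem_saws_le => /andP[/andP[_ sb] bb]; rewrite exprMn.
  apply: ler_wpM2r; first exact: exprn_ge0.
  by apply: ler_wiXn2l => //; apply: bridge_size sb bb.
rewrite -mulr_sumr -[leRHS]mulr1; apply: ler_wpM2l; first exact: exprn_ge0.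
exact: bridge_sum_crit.
Qed.
End Bridges.

(** * Decomposition of half-plane walks into bridges *)

Definition in_strip (T : nat) (u : hexv) (w : seq hexv) : bool :=
  all (fun z => 0 <= height u z <= 2 * T%:Z) w.

Lemma height_adj u x y : hex_adj x y -> `|height u y - height u x| = 1.
Proof. by move/column_adj; rewrite /height; case: ifP => _; lia. Qed.

Lemma height_self u : height u u = 0. Proof. by rewrite /height subrr if_same. Qed.

Lemma height_flip u z v k : height u z = 2 * k + 1 -> height z v = height u z - height u v.
Proof.
by case: u z v => [[a b] []] [[c d] []] [[e f] s]; rewrite /height /=; lia.
Qed.

(** At even height a vertex belongs to the sublattice of [u], and only one of its
    three edges leads down. *)
Lemma lower_nbr u z a b k : height u z = 2 * k -> hex_adj z a -> hex_adj z b ->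
  height u a = height u z - 1 -> height u b = height u z - 1 -> a = b.
Proof.
case: u z => [[a1 b1] []] [[c d] []] + /nbrP /= h /nbrP /= h'.
all: case: h => -[-> _]; case: h' => -[-> _] //; rewrite /height /=; lia.
Qed.

(** A walk cannot pass through a vertex of even maximal height: it would have to
    use the only edge leading down twice. *)
Lemma top_end u k s1 z s2 : sorted hex_adj (s1 ++ z :: s2) ->
  uniq (s1 ++ z :: s2) -> all (fun v => height u v <= 2 * k) (s1 ++ z :: s2) ->
  height u z = 2 * k -> s1 = [::] \/ s2 = [::].
Proof.
case/lastP: s1 => [|s1 a]; first by left.
case: s2 => [|b s2]; first by right.
rewrite cat_rcons => so un al hz.
have /and3P[az zb _] : path hex_adj a [:: z, b & s2].
  by move: so; case: s1 {un al} => [|c s1] //=; rewrite cat_path => /andP[_ /andP[]].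
have za : hex_adj z a by rewrite hex_adj_sym.
have ha : height u a <= 2 * k by apply: (allP al); rewrite mem_cat inE eqxx orbT.
have hb : height u b <= 2 * k by apply: (allP al); rewrite mem_cat !inE eqxx !orbT.
have ab : a = b.
  apply: (lower_nbr hz za zb); first by have := height_adj u za; lia.
  by have := height_adj u zb; lia.
by move: un; rewrite cat_uniq ab cons_uniq !inE eqxx orbT => /and3P[].
Qed.

Lemma below_level u k x p : path hex_adj x p -> height u x < k ->
  all (fun v => height u v != k) p -> all (fun v => height u v < k) (x :: p).
Proof.
elim: p x => [|y p IH] x /=; first by move=> _ ->.
move=> /andP[xy yp] hx /andP[hy in_strip]; rewrite hx /=.
by apply: IH => //; have := height_adj u xy; lia.
Qed.

Lemma split_last (A : Type) (a : pred A) s : has a s ->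
  exists s1 z s2, [/\ s = rcons s1 z ++ s2, a z & ~~ has a s2].
Proof.
elim: s => //= x s IH; have [/IH [s1 [z [s2 [-> az as2]]]] _|as_] := boolP (has a s).
  by exists (x :: s1), z, s2.
by rewrite orbF => ax; exists [::], x, s.
Qed.

Lemma in_split (A : eqType) (x : A) s : x \in s -> exists s1 s2, s = s1 ++ x :: s2.
Proof. by case/splitPr => s1 s2; exists s1, s2. Qed.

Section Tails.
Variables (T N : nat).

Definition extensions (r : seq hexv) : seq (seq hexv) :=
  r :: [seq rcons r e | e <- hex_nbrs (last start r)].

Definition tails2 (z : hexv) : seq (seq hexv) :=
  [seq r' | r <- [seq r <- saws_le N z | in_strip T z r], r' <- extensions r].

Definition tails1 (z : hexv) : seq (seq hexv) :=
  [:: z] :: [seq z :: r | y <- hex_nbrs z, r <- tails2 y].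

(** What may follow the end [z] of a bridge of width [T + 1] in a walk that does
    not come back to the height of [z]: nothing, one vertex, or one vertex and
    a walk in a strip of width [T] in the opposite direction, up to one more
    vertex at its end. *)
Definition tails (z : hexv) : seq (seq hexv) :=
  [::] :: [seq r | y <- hex_nbrs z, r <- tails1 y].

(** Cut the walk at its last visit [z] to height [2 * T + 1].  Up to [z] it is a
    bridge, since by [top_end] it cannot have been higher before.  After [z] it
    either goes up, and stops at once because the vertex above is a dead end in
    the strip, or goes down; from its second step down it then remains in the
    strip of width [T] below, where by [top_end] only its last vertex can be at
    the excluded height [2 * T]. *)
Lemma hw_split u w : (size w <= N)%N -> is_saw u w -> in_strip T.+1 u w -> ~~ in_strip T u w ->
  exists b r, [/\ w = b ++ r, is_saw u b, is_bridge T.+1 u b & r \in tails (last u b)].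
Proof.
move=> sN ws h1 h0; have [w0 hw so un] := and4P ws.
have hu v : v \in w -> 0 <= height u v <= 2 * T%:Z + 2.
  by move=> vw; move: (allP h1 _ vw); clear; lia.
have [s1 [z [s2 [wE /eqP hz hs2]]]] : exists s1 z s2, [/\ w = rcons s1 z ++ s2,
    height u z == 2 * T%:Z + 1 & ~~ has (fun v => height u v == 2 * T%:Z + 1) s2].
  apply: split_last; apply: contraNT h0 => /hasPn h0.
  case: w w0 hw so hu h0 {ws h1 un sN} => [|v p] //= _ /eqP -> up hu h0.
  have /allP lt : all (fun x => height u x < 2 * T%:Z + 1) (u :: p).
    apply: below_level up _ _; first by rewrite height_self; clear; lia.
    by apply/allP => x xp; apply: h0; rewrite inE xp orbT.
  change (in_strip T u (u :: p)).
  by apply/allP => x xw; move: (lt x xw) (hu x xw); clear; lia.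
have bs : is_saw u (rcons s1 z).
  move: so un hw; rewrite /is_saw wE cat_uniq => so /and3P[-> _ _] hw; rewrite andbT.
  apply/and3P; split; first by case: (s1).
    by move: hw; case: (s1).
  by move: so; case: (s1) => [|c s] //=; rewrite cat_path => /andP[].
have bT : is_bridge T.+1 u (rcons s1 z).
  rewrite /is_bridge last_rcons hz; apply/andP; split; last by clear; lia.
  apply/allP => v vb; have vw : v \in w by rewrite wE mem_cat vb.
  have hv0 := hu v vw; suff : height u v <> 2 * (T%:Z + 1) by move: hv0; clear; lia.
  have [_ hb sob unb] := and4P bs.
  have alb : all (fun v => height u v <= 2 * (T%:Z + 1)) (rcons s1 z).
    by apply/allP => x xb; move: (hu x); rewrite wE mem_cat xb => /(_ isT); clear; lia.
  move: (last_rcons u s1 z) hb sob unb alb.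
  case/splitPr: vb => t1 t2 lz hb sob unb alb hv.
  have [t1E|t2E] := top_end sob unb alb hv.
    by move: hb hv; rewrite t1E /= => /eqP ->; rewrite height_self; clear; lia.
  by move: lz hv hz; rewrite t2E last_cat /= => ->; clear; lia.
exists (rcons s1 z), s2; split=> //; rewrite last_rcons.
have zs2 : path hex_adj z s2.
  by move: so; rewrite wE; case: (s1) => [|c s] //=; rewrite cat_path last_rcons => /andP[].
have un2 : uniq s2 by move: un; rewrite wE cat_uniq => /and3P[].
have hu2 v : v \in s2 -> 0 <= height u v <= 2 * T%:Z + 2 /\ height u v <> 2 * T%:Z + 1.
  move=> vs; split; first by apply: hu; rewrite wE mem_cat vs orbT.
  by apply/eqP; exact: (hasPn hs2 v vs).
have sz2 : (size s2 <= N)%N by apply: leq_trans sN; rewrite wE size_cat leq_addl.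
move: zs2 un2 hu2 sz2; clear -hz; case: s2 => [|z1 r]; first by rewrite mem_head.
move=> /= /andP[zz1 z1r] /andP[_ unr] hu szr.
rewrite inE; apply/orP; right; apply/allpairsPdep; exists z1, (z1 :: r); split=> //.
case: r z1r unr hu szr => [|z2 r]; first by rewrite mem_head.
move=> /= /andP[z12 z2r] unr hu szr.
have [hz1 hz2] : height u z1 = 2 * T%:Z /\ height u z2 = 2 * T%:Z - 1.
  have := hu z1 (mem_head _ _); have := hu z2; rewrite !inE eqxx orbT => /(_ isT).
  by have := height_adj u zz1; have := height_adj u z12; rewrite hz; clear; lia.
rewrite inE; apply/orP; right; apply/allpairsPdep; exists z2, (z2 :: r); split=> //.
have hr v : v \in z2 :: r -> height u v <= 2 * T%:Z.
  have /allP lt : all (fun v => height u v < 2 * T%:Z + 1) (z2 :: r).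
    apply: below_level z2r _ _; first by rewrite hz2; clear; lia.
    apply/allP => x xr; have := hu x; rewrite !inE xr !orbT => /(_ isT) [_ h].
    exact/eqP.
  by move/lt; clear; lia.
have top v : v \in z2 :: r -> height u v = 2 * T%:Z -> v = last z2 r.
  move=> vr hv; have so : sorted hex_adj (z2 :: r) by [].
  have al : all (fun v => height u v <= 2 * T%:Z) (z2 :: r) by apply/allP.
  have un : uniq (z2 :: r) by [].
  have [t1 [t2 E]] := in_split vr; rewrite E in so al un.
  have [t1E|t2E] := top_end so un al hv.
    by move: E hv; rewrite t1E => -[<- _]; rewrite hz2; clear; lia.
  by have := congr1 (last v) E; rewrite t2E last_cat.
(* Heights relative to z2 run downwards. *)
have flip v : height z2 v = 2 * T%:Z - 1 - height u v.
  by rewrite (@height_flip u z2 v (T%:Z - 1)) hz2 //; clear; lia.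
have in_hp r0 : sorted hex_adj (z2 :: r0) -> uniq (z2 :: r0) ->
    (size (z2 :: r0) <= N)%N -> (forall v, v \in z2 :: r0 ->
      0 <= height u v /\ height u v < 2 * T%:Z) ->
    z2 :: r0 \in [seq s <- saws_le N z2 | in_strip T z2 s].
  move=> so un sz h; rewrite mem_filter mem_saws_le sz /is_saw so un eqxx !andbT.
  by apply/allP => v /h; rewrite flip; clear; lia.
have hr0 v : v \in z2 :: r -> 0 <= height u v.
  by move=> vr; have := hu v; rewrite !inE -in_cons vr !orbT => /(_ isT) [/andP[]].
have szr2 : (size (z2 :: r) <= N)%N by exact: ltnW.
have [top_last|not_top] := eqVneq (height u (last z2 r)) (2 * T%:Z).
  case/lastP: r z2r unr szr2 hr0 hr top top_last {hu szr} => [|r e] z2r unr szr2 hr0 hr top.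
    by rewrite /= hz2; clear; lia.
  rewrite last_rcons => he.
  apply/allpairsPdep; exists (z2 :: r), (z2 :: rcons r e); split=> //.
    apply: in_hp.
    - by move: z2r; rewrite rcons_path => /andP[].
    - by move: unr; rewrite /= mem_rcons in_cons negb_or rcons_uniq => /and3P[/andP[_ ->] _ ->].
    - by move: szr2; rewrite /= size_rcons; exact: ltnW.
    - move=> v vr; have vre : v \in z2 :: rcons r e.
        by rewrite -rcons_cons mem_rcons in_cons vr orbT.
      split; first exact: hr0.
      have : height u v != 2 * T%:Z.
        apply/eqP => /(top _ vre); rewrite last_rcons => ve.
        by move: unr; rewrite -[_ && _]/(uniq (rcons (z2 :: r) e)) rcons_uniq -ve vr.
      by have := hr v vre; clear; lia.
  rewrite inE; apply/orP; right; apply/mapP; exists e => //=.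
  by move: z2r; rewrite rcons_path => /andP[].
apply/allpairsPdep; exists (z2 :: r), (z2 :: r); split=> //; last exact: mem_head.
apply: in_hp => // v vr; split; first exact: hr0.
have : height u v != 2 * T%:Z.
  by apply: contraNneq not_top => hv; rewrite -(top v vr hv) hv.
by have := hr v vr; clear; lia.
Qed.

Section TailSum.
Variable R : realType.

(** Each vertex has 3 neighbours and [y <= 1], so the weight is at most
    [1 + 3 * (1 + 3 * 4 * h)]. *)
Lemma tails_sum z (y h : R) : 0 <= y <= 1 -> 1 <= h ->
  (forall v, \sum_(w <- saws_le N v | in_strip T v w) y ^+ size w <= h) ->
  \sum_(r <- tails z) y ^+ size r <= 40 * h.
Proof.
move=> /andP[y0 y1] h1 hh.
have s3 v : size (hex_nbrs v) = 3 by case: v => [[a b] s].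
have sum3 (F : hexv -> R) v (c : R) : (forall x, F x <= c) ->
    \sum_(x <- hex_nbrs v) F x <= 3 * c.
  move=> Fc; apply: (@le_trans _ _ (\sum_(x <- hex_nbrs v) c)).
    exact: ler_sum.
  by rewrite big_const_seq count_predT s3 iter_addr addr0 mulr_natl.
have t2 v : \sum_(r <- tails2 v) y ^+ size r <= 4 * h.
  rewrite big_allpairs_dep /= big_filter.
  apply: (@le_trans _ _ (\sum_(w <- saws_le N v | in_strip T v w) 4 * y ^+ size w)).
    apply: ler_sum => w _; rewrite big_cons big_map /=.
    under eq_bigr do rewrite size_rcons.
    rewrite big_const_seq count_predT s3 iter_addr addr0 exprS.
    have := exprn_ge0 (size w) y0; move: (y ^+ size w) => e e0.
    by rewrite mulr_natl -mulr_natl; nra.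
  by rewrite -mulr_sumr ler_pM2l.
have t1 v : \sum_(r <- tails1 v) y ^+ size r <= 13 * h.
  rewrite big_cons big_allpairs_dep /= expr1.
  have := sum3 (fun x => \sum_(r <- tails2 x) y ^+ size (v :: r)) v (4 * h).
  have H x : \sum_(r <- tails2 x) y ^+ size (v :: r) <= 4 * h.
    under eq_bigr do rewrite /= exprS.
    rewrite -mulr_sumr; have := t2 x.
    have : 0 <= \sum_(r <- tails2 x) y ^+ size r by apply: sumr_ge0 => r _; exact: exprn_ge0.
    by nra.
  by move=> /(_ H); lra.
rewrite big_cons big_allpairs_dep /= expr0.
have := sum3 (fun x => \sum_(r <- tails1 x) y ^+ size r) z (13 * h) t1.
by lra.
Qed.

End TailSum.
End Tails.

Section HalfPlane.
Variable R : realType.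

Lemma hw_step T N (y h beta : R) : 0 <= y <= 1 -> 1 <= h ->
  (forall u, \sum_(w <- saws_le N u | in_strip T u w) y ^+ size w <= h) ->
  (forall u, \sum_(b <- saws_le N u | is_bridge T.+1 u b) y ^+ size b <= beta) ->
  forall u, \sum_(w <- saws_le N u | in_strip T.+1 u w) y ^+ size w <= h * (1 + 40 * beta).
Proof.
move=> y01 h1 hh hb u; have /andP[y0 y1] := y01.
rewrite (bigID (in_strip T u)) /= mulrDr mulr1; apply: lerD.
  apply: le_trans (hh u); rewrite big_mkcond [leRHS]big_mkcond /=.
  apply: ler_sum => w _; case: (in_strip T u w); rewrite ?andbF ?andbT //.
  by case: ifP => // _; exact: exprn_ge0.
rewrite -big_filter.
pose t := [seq (b, r) | b <- [seq b <- saws_le N u | is_bridge T.+1 u b],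
  r <- tails T N (last u b)].
have tE : \sum_(br <- t) y ^+ (size br.1 + size br.2) =
    \sum_(b <- saws_le N u | is_bridge T.+1 u b)
      y ^+ size b * \sum_(r <- tails T N (last u b)) y ^+ size r.
  rewrite big_allpairs_dep big_filter; apply: eq_bigr => b _ /=.
  by rewrite mulr_sumr; apply: eq_bigr => r _; rewrite exprD.
apply: (@le_trans _ _ (\sum_(br <- t) y ^+ (size br.1 + size br.2))).
  apply: (@sum_cover _ _ _ _ _ (fun br => br.1 ++ br.2)).
  - by apply/filter_uniq/uniq_saws_le.
  - by move=> br _; exact: exprn_ge0.
  move=> w; rewrite mem_filter mem_saws_le => /andP[/andP[h2 h0] /andP[sN ws]].
  have [b [r [wE bs bT rt]]] := hw_split sN ws h2 h0.
  exists (b, r); split; rewrite ?wE ?size_cat //.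
  apply/allpairsPdep; exists b, r; split=> //.
  rewrite mem_filter bT mem_saws_le bs andbT.
  by apply: leq_trans sN; rewrite wE size_cat leq_addr.
rewrite tE; apply: (@le_trans _ _ (\sum_(b <- saws_le N u | is_bridge T.+1 u b)
    y ^+ size b * (40 * h))).
  by apply: ler_sum => b _; rewrite ler_wpM2l ?exprn_ge0 // tails_sum.
have -> : h * (40 * beta) = beta * (40 * h) by ring.
by rewrite -mulr_suml ler_wpM2r ?hb //; lra.
Qed.

Lemma in_strip0 u w : is_saw u w -> in_strip 0 u w -> w = [:: u].
Proof.
case: w => [|v [|z p]] // /and4P[_ /eqP /= -> so un]; first by [].
move=> /and3P[_ hz _]; case/andP: so => /(height_adj u); rewrite height_self.
by move: hz; clear; lia.
Qed.

(** The widths of the successive bridges decrease strictly, so that the weight is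
    at most the product of the factors [1 + 40 * r ^+ t] over all widths [t]. *)
Lemma in_strip_bound (x r : R) : 0 <= x <= 1 -> 0 <= r < 1 ->
  x * (2 * cos (pi / 8)) = 1 -> forall T N u,
  \sum_(w <- saws_le N u | in_strip T u w) (r * x) ^+ size w <= expR (40 / (1 - r)).
Proof.
move=> /andP[x0 x1] /andP[r0 r1] hx T N.
have y01 : 0 <= r * x <= 1 by nra.
have r01 : 0 <= r <= 1 by rewrite r0 ltW.
have r1' : 0 < 1 - r by rewrite subr_gt0.
suff H : forall u, \sum_(w <- saws_le N u | in_strip T u w) (r * x) ^+ size w <=
    expR (40 * \sum_(t < T) r ^+ t.+1).
  move=> u; apply: le_trans (H u) _; rewrite ler_expR; apply: ler_wpM2l => //.
  rewrite -[leRHS]div1r ler_pdivlMr //.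
  have -> : (\sum_(t < T) r ^+ t.+1) * (1 - r) = r - r ^+ T.+1.
    elim: (T) => [|n IH]; first by rewrite big_ord0 mul0r expr1 subrr.
    by rewrite big_ord_recr /= mulrDl IH !exprS; ring.
  by have := exprn_ge0 T.+1 r0; lra.
elim: T => [|T IH] u.
  rewrite big_ord0 mulr0 expR0.
  apply: (@le_trans _ _ (\sum_(w <- [:: [:: u]]) 1)); last by rewrite big_seq1.
  rewrite -big_filter; apply: (@sum_cover _ _ _ _ _ id) => //.
    exact/filter_uniq/uniq_saws_le.
  move=> w; rewrite mem_filter mem_saws_le => /andP[h /andP[_ ws]].
  rewrite (in_strip0 ws h); exists [:: u]; split; rewrite ?mem_head //.
  by rewrite expr1; case/andP: y01.
have h1 : 1 <= expR (40 * \sum_(t < T) r ^+ t.+1) :> R.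
  rewrite -[leLHS]expR0 ler_expR mulr_ge0 // sumr_ge0 // => t _; exact: exprn_ge0.
have hb v : \sum_(b <- saws_le N v | is_bridge T.+1 v b) (r * x) ^+ size b <= r ^+ T.+1.
  exact: bridge_sum.
apply: le_trans (hw_step y01 h1 IH hb u) _.
rewrite big_ord_recr /= [X in _ <= expR X]mulrDr expRD ler_pM2l ?expR_gt0 //.
exact: expR_ge1Dx.
Qed.

End HalfPlane.

(** * Decomposition of walks into two half-plane walks *)

Lemma min_column (w : seq hexv) : w != [::] ->
  exists2 z, z \in w & forall z', z' \in w -> column z <= column z'.
Proof.
elim: w => // x [|y w] IH _.
  by exists x => [|z']; rewrite ?mem_head // inE => /eqP ->.
have [z zw zm] := IH isT; case: (leP (column x) (column z)) => xz.
  exists x => [|z']; first exact: mem_head.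
  by rewrite inE => /orP[/eqP -> //|/zm]; exact: le_trans.
exists z => [|z']; first by rewrite inE zw orbT.
by rewrite inE => /orP[/eqP ->|/zm //]; exact: ltW.
Qed.

Definition right_half (u : hexv) (p : seq hexv) : bool :=
  is_saw u p && all (fun z => column u <= column z) p.

(** Removal of nothing, of the first or of the last element for [k = 0, 1, 2]. *)
Definition trim (k : nat) (l : seq hexv) : seq hexv :=
  if k is k'.+1 then (if k' is 0%N then behead l else take (size l).-1 l) else l.

(** Cut the walk at a vertex [z] of minimal column.  If [z] is on the sublattice
    [true], the two parts are walks in the half-plane to its right.  Otherwise
    [z] has only one neighbour on that side, so it is an end of the walk;
    prolonging the walk there by a vertex [u] further left gives a half-plane
    walk, from which [u] has to be trimmed. *)
Lemma full_split v w : is_saw v w -> exists k u p q,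
  [/\ (k < 3)%N && u.2, right_half u p, right_half u q,
      trim k (rev p ++ behead q) = w & (size p + size q <= size w + 2)%N].
Proof.
move=> /and4P[w0 _ so un]; have [z zw zm] := min_column w0.
have [s1 [s2 wE]] := in_split zw.
have [zt|zf] := boolP z.2.
  exists 0%N, z, (z :: rev s1), (z :: s2); rewrite zt; split=> //.
  - apply/andP; split; last first.
      apply/allP => y; rewrite inE mem_rev => yw; apply: zm.
      by rewrite wE mem_cat inE; case/orP: yw => ->; rewrite ?orbT.
    rewrite /is_saw /= eqxx /=; apply/andP; split.
      have : sorted hex_adj (rev (rcons s1 z)).
        rewrite adj_rev; move: so; rewrite wE -cat_rcons.
        by case: (s1) => [|c s] //=; rewrite cat_path => /andP[].
      by rewrite rev_rcons.
    move: un; rewrite wE -cat_rcons cat_uniq rcons_uniq => /andP[/andP[zs1 us1] _].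
    by rewrite mem_rev rev_uniq zs1.
  - apply/andP; split; last first.
      by apply/allP => y yw; apply: zm; rewrite wE mem_cat yw orbT.
    rewrite /is_saw /= eqxx /=; apply/andP; split.
      by move: so; rewrite wE; case: (s1) => [|c s] //=; rewrite cat_path => /andP[_ /andP[]].
    by move: un; rewrite wE cat_uniq => /and3P[].
  - by rewrite /= rev_cons revK cat_rcons.
  - by rewrite /= size_rev wE size_cat /=; clear; lia.
pose u : hexv := let: (a, b, _) := z in (a - 1, b, true).
have ut : u.2 by rewrite /u; case: (z) => [[a b] s].
have uz : hex_adj u z.
  by move: zf; rewrite /u; case: (z) => [[a b] []] // _; rewrite /hex_adj !inE subrK eqxx orbT.
have uc : column u = column z - 1.
  by move: zf; rewrite /u; case: (z) => [[a b] []] //= _; lia.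
have uw : u \notin w by apply/negP => /zm; rewrite uc; clear; lia.
have ru : right_half u [:: u] by rewrite /right_half /is_saw /= eqxx lexx.
have allu y : y \in w -> column u <= column y.
  by move/zm; rewrite uc; clear; lia.
have rz : forall w', perm_eq w' w -> head start w' = z -> sorted hex_adj w' ->
    right_half u (u :: w').
  move=> w' ww' hw' so'; rewrite /right_half /is_saw /= eqxx lexx /=.
  rewrite (perm_mem ww') uw (perm_uniq ww') un (perm_all _ ww').
  apply/andP; split; last exact/allP.
  rewrite andbT; case: w' hw' so' {ww'} => [|y w'] //= -> ->; rewrite andbT.
  by rewrite [hex_adj _ _]uz.
(* Heights relative to z run to the left, and z is at their maximum 0. *)
have hz y : y \in w -> height z y <= 2 * 0.
  by move/zm; rewrite /height (negbTE zf); clear; lia.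
rewrite wE in so un.
have al : all (fun y => height z y <= 2 * 0) (s1 ++ z :: s2) by rewrite -wE; apply/allP.
have h0 : height z z = 2 * 0 by rewrite height_self.
have [s1E|s2E] := top_end so un al h0.
  exists 1%N, u, [:: u], (u :: w); split=> //; last by rewrite /= addn2 add1n.
  by apply: rz => //; [rewrite wE s1E|rewrite wE].
exists 2%N, u, (u :: rev w), [:: u]; split=> //.
- apply: rz; first by rewrite perm_rev.
    by rewrite head_rev wE s2E last_cat.
  by rewrite adj_rev wE.
- by rewrite /= rev_cons revK cats0 size_rcons /= -cats1 take_size_cat.
- by rewrite /= size_rev addn1 addn2.
Qed.

(** * Bounds on the number of walks *)

Lemma saw_countE v n : saw_count v n = size (saws n v).
Proof.
have mem_saw (t : n.+1.-tuple hexv) : (t \in fset_set (saw v n)) = (tval t \in saws n v).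
  rewrite in_fset_set; last exact: finite_saw.
  rewrite mem_saws size_tuple eqxx /is_saw /=.
  apply/idP/idP; rewrite inE.
    case=> tv ts tu; case/tupleP: t tv ts tu => x t /=; rewrite theadE => -> ts tu.
    by rewrite eqxx ts tu.
  by case/tupleP: t => x t /= /and3P[/eqP xv ts tu]; split=> //; rewrite theadE.
rewrite /saw_count.
have -> : size (saws n v) = size (map val (enum_fset (fset_set (saw v n)))).
  apply/perm_size/uniq_perm.
  - exact/filter_uniq/uniq_walks.
  - by rewrite (map_inj_uniq val_inj) fset_uniq.
  move=> w; apply/idP/mapP => [wn|[t tin ->]]; last by rewrite -mem_saw.
  have sw : size w == n.+1 by move: wn; rewrite mem_saws => /andP[].
  by exists (Tuple sw) => //; rewrite -[_ \in _]/(_ \in fset_set _) mem_saw.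
by rewrite size_map.
Qed.

(** A symmetry carries [start] to [v]. *)
Lemma walks_in_le_saws (D : pred hexv) n v : D second ->
  (size (walks_in D n) <= size (saws n.+1 v))%N.
Proof.
move=> d1; pose g := symmetry (~~ v.2) v.1.
have gb : g start = v.
  by rewrite /g /start; case: v {g} => [[a b] []]; rewrite /symmetry /= ?subr0 ?addr0.
rewrite -(size_map (fun w => map g (rev w))); apply: uniq_leq_size.
  rewrite map_inj_uniq ?uniq_walks_in // => w w' /(inj_map (@symmetry_inj _ _)).
  exact: (can_inj revK).
move=> _ /mapP[w + ->]; rewrite mem_walks_in // => /andP[/eqP sw /and4P[so un /suffixP[u wE] _]].
rewrite mem_saws size_map size_rev sw eqxx /is_saw (map_inj_uniq (@symmetry_inj _ _)).
rewrite rev_uniq un andbT; apply/and4P; split=> //.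
- by apply/eqP => /(congr1 size); rewrite size_map size_rev sw.
- by apply/eqP; rewrite wE rev_cat; exact: gb.
- rewrite sorted_map; have : sorted hex_adj (rev w) by rewrite adj_rev.
  case: (rev w) => [|y t] //=.
  by rewrite (eq_path (e' := relpre g hex_adj)) // => a b; rewrite /= symmetry_adj.
Qed.

Section Counting.
Variable R : realType.

Lemma saws_lower (x : R) v n : 0 <= x -> x * (2 * cos (pi / 8)) = 1 ->
  1 <= x ^+ n * (size (saws n.+1 v))%:R.
Proof.
move=> x0 hx; apply: le_trans (slit_lower_bound n x0 hx) _.
by rewrite ler_wpM2l ?exprn_ge0 // ler_nat walks_in_le_saws // slit_second.
Qed.

Definition origin_halves (N : nat) : seq (seq hexv) :=
  [seq w <- saws_le N start | in_strip N start w].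

Lemma right_half_shift N (u : hexv) p : u.2 -> right_half u p -> (size p <= N)%N ->
  map (symmetry false (- u.1)) p \in origin_halves N.
Proof.
move=> ut /andP[up /allP hc] sN.
have cE z : column (symmetry false (- u.1) z) = column z - column u + 1.
  by move: ut; case: (u) z => [[a b] []] // [[c d] s] _; rewrite /symmetry /=; lia.
have [p0 /eqP hu so un] := and4P up.
rewrite mem_filter mem_saws_le size_map sN /=; apply/andP; split.
  apply/allP => _ /mapP[z zp ->]; rewrite /height [_.2]/= cE.
  have := hc z zp; have : `|column z - column u| <= N%:Z.
    case: p hu so zp sN {up hc p0 un} => [|y p] //= -> so zp sN.
    have cL a b : hex_adj a b -> `|column b - column a| <= 1 by move/column_adj => ->.
    by move: (lipschitz_path cL so zp) sN; clear; lia.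
  by clear; rewrite /=; lia.
rewrite /is_saw (map_inj_uniq (@symmetry_inj _ _)) un andbT; apply/and3P; split.
- by case: (p) p0.
- case: p hu {up hc sN p0 so un} => [|y p] /= hu; first by [].
  by rewrite hu; move: ut; case: (u) => [[a b] []] // _; rewrite /symmetry /= !addNr.
- rewrite sorted_map; case: p so {up hc sN p0 un hu} => [|y t] //=.
  rewrite (eq_path (e' := relpre (symmetry false (- u.1)) hex_adj)) // => a b.
  by rewrite /= symmetry_adj.
Qed.

Lemma trim_map (f : hexv -> hexv) k l : trim k (map f l) = map f (trim k l).
Proof. by case: k => [|[|k]] //=; rewrite ?behead_map // size_map map_take. Qed.

(** Translate the two halves to a common origin.  The walk is recovered from them
    because its first vertex [v] is given. *)
Lemma saws_upper (y : R) v n : 0 < y <= 1 ->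
  (size (saws n v))%:R * y ^+ (n + 3) <=
  3 * (\sum_(w <- origin_halves (n + 3)) y ^+ size w) ^+ 2.
Proof.
move=> /andP[y0 y1]; set H := origin_halves _.
pose t := [seq (k, pq) | k <- iota 0 3, pq <- [seq (p, q) | p <- H, q <- H]].
have -> : 3 * (\sum_(w <- H) y ^+ size w) ^+ 2 =
    \sum_(kpq <- t) y ^+ (size kpq.2.1 + size kpq.2.2).
  have -> : (\sum_(w <- H) y ^+ size w) ^+ 2 =
      \sum_(pq <- [seq (p, q) | p <- H, q <- H]) y ^+ (size pq.1 + size pq.2).
    rewrite big_allpairs_dep /= expr2 mulr_suml.
    apply: eq_bigr => p _; rewrite mulr_sumr; apply: eq_bigr => q _.
    by rewrite exprD.
  by rewrite [RHS]big_allpairs_dep /= !big_cons big_nil; ring.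
have -> : (size (saws n v))%:R * y ^+ (n + 3) = \sum_(w <- saws n v) y ^+ (n + 3).
  by rewrite big_const_seq count_predT iter_addr addr0 mulr_natl.
pose back l := map (symmetry false (v.1 - (head start l).1)) l.
apply: (@sum_cover _ _ _ _ _ (fun kpq =>
  back (trim kpq.1 (rev kpq.2.1 ++ behead kpq.2.2)))).
- exact/filter_uniq/uniq_walks.
- by move=> kpq _; apply: exprn_ge0; exact: ltW.
move=> w; rewrite mem_saws => /andP[/eqP sw ws].
have [k [u [p [q [/andP[k3 ut] hp_ hq wE spq]]]]] := full_split ws.
pose s := symmetry false (- u.1).
exists (k, (map s p, map s q)); split=> /=.
- have p0 : (0 < size p)%N by case/andP: hp_ => /and4P[]; case: (p).
  have q0 : (0 < size q)%N by case/andP: hq => /and4P[]; case: (q).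
  apply/allpairsPdep; exists k, (map s p, map s q); split=> //.
    by rewrite mem_iota.
  apply/allpairsPdep; exists (map s p), (map s q); split=> //.
    by apply: right_half_shift => //; move: spq q0; rewrite sw; clear; lia.
  by apply: right_half_shift => //; move: spq p0; rewrite sw; clear; lia.
- rewrite -map_rev behead_map -map_cat trim_map wE.
  have hd : head start (map s w) = s v.
    by case: w sw ws {wE spq} => [|c w] // _ /and4P[_ /eqP /= -> _ _].
  rewrite /back hd -map_comp map_id_in // => z _; rewrite /= /s /symmetry.
  case: (v) (u) z => [[a1 b1] s1] [[a2 b2] s2] [[a3 b3] s3] /=.
  by congr (_, _, _); lia.
- rewrite !size_map; apply: ler_wiXn2l => //; first exact: ltW.
  by move: spq; rewrite sw; clear; lia.
Qed.

Lemma saws_upper_crit (x r : R) v n : 0 < x <= 1 -> 0 < r < 1 ->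
  x * (2 * cos (pi / 8)) = 1 ->
  (size (saws n v))%:R * (r * x) ^+ (n + 3) <= 3 * expR (40 / (1 - r)) ^+ 2.
Proof.
move=> /andP[x0 x1] /andP[r0 r1] hx.
have y0 : 0 < r * x <= 1 by rewrite mulr_gt0 //=; nra.
apply: le_trans (saws_upper _ _ y0) _; apply: ler_wpM2l => //.
have S0 : 0 <= \sum_(w <- origin_halves (n + 3)) (r * x) ^+ size w.
  by apply: sumr_ge0 => w _; apply: exprn_ge0; case/andP: y0 => /ltW.
rewrite ler_pXn2r ?nnegrE ?expR_ge0 // /origin_halves big_filter.
by apply: in_strip_bound => //; rewrite ?(ltW x0) ?(ltW r0).
Qed.

End Counting.

(** * The limit of the n-th roots *)

Section Limit.
Variable R : realType.

Lemma two_cos_pi8 : 2 * cos (pi / 8) = Num.sqrt (2 + Num.sqrt 2) :> R.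
Proof.
have pi0 := pi_gt0 R.
have double (a : R) : cos (a + a) = 2 * cos a ^+ 2 - 1.
  by rewrite cosD -!expr2 sin2cos2; ring.
have c4 : 2 * cos (pi / 4) = Num.sqrt 2 :> R.
  have c0 : 0 <= cos (pi / 4) :> R by apply: cos_ge0_pihalf; apply/andP; split; lra.
  have := double (pi / 4); have -> : pi / 4 + pi / 4 = pi / 2 :> R by field.
  rewrite cos_pihalf => h; apply/eqP.
  rewrite -(@eqrXn2 _ 2) ?sqr_sqrtr ?mulr_ge0 ?sqrtr_ge0 //.
  by apply/eqP; rewrite exprMn; lra.
have c0 : 0 <= cos (pi / 8) :> R by apply: cos_ge0_pihalf; apply/andP; split; lra.
have := double (pi / 8); have -> : pi / 8 + pi / 8 = pi / 4 :> R by field.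
move=> h; apply/eqP.
rewrite -(@eqrXn2 _ 2) ?sqr_sqrtr ?mulr_ge0 ?addr_ge0 ?sqrtr_ge0 //.
by apply/eqP; rewrite exprMn -c4; lra.
Qed.

Lemma cvg_root (C : R) : 0 < C -> (fun n : nat => C `^ n%:R^-1) @ \oo --> (1 : R).
Proof.
move=> C0.
have -> : (fun n : nat => C `^ n%:R^-1) = (fun n : nat => expR (n%:R^-1 * ln C)).
  by apply/funext => n; rewrite /powR gt_eqF.
rewrite -[X in _ --> X]expR0; apply: continuous_cvg; first exact: continuous_expR.
rewrite -[X in _ --> X](mul0r (ln C)); apply: cvgMl.
apply/gtr0_cvgV0; last exact: cvgr_idn.
by exists 1%N => // n /= n0; rewrite ltr0n.
Qed.

Lemma saw_root_cvg v :
  saw_root R v @ \oo --> (Num.sqrt (2 + Num.sqrt 2) : R).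
Proof.
set mu : R := Num.sqrt _.
have s2 : 0 <= Num.sqrt 2 :> R := sqrtr_ge0 _.
have mu1 : 1 <= mu by rewrite -sqrtr1 /mu ler_sqrt; lra.
have mu0 : 0 < mu by lra.
have hx : mu^-1 * (2 * cos (pi / 8)) = 1 by rewrite two_cos_pi8 mulVf ?gt_eqF.
have x01 : 0 < mu^-1 <= 1 by rewrite invr_gt0 mu0 invf_le1.
have root n (a : R) : 0 <= a -> (0 < n)%N -> (a ^+ n) `^ n%:R^-1 = a.
  move=> a0 n0; rewrite -powR_mulrn // -powRrM mulfV ?powRr1 //.
  by rewrite pnatr_eq0 -lt0n.
have root_le n (a b : R) : 0 <= a -> a <= b -> a `^ n%:R^-1 <= b `^ n%:R^-1.
  move=> a0 ab; apply: ge0_ler_powR => //; rewrite ?nnegrE ?invr_ge0 //.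
  exact: le_trans ab.
have lower n : (0 < n)%N -> mu * (mu^-1 `^ n%:R^-1) <= saw_root R v n.
  case: n => // n _; rewrite -[X in X * _ <= _](root n.+1) ?(ltW mu0) //.
  rewrite -powRM ?exprn_ge0 ?invr_ge0 ?(ltW mu0) //.
  apply: root_le; first by rewrite mulr_ge0 ?exprn_ge0 ?invr_ge0 // ltW.
  rewrite exprSr mulfK ?gt_eqF // saw_countE.
  have := saws_lower v n (ltW (proj1 (andP x01))) hx.
  by rewrite exprVn mulrC ler_pdivlMr ?exprn_gt0 // mul1r.
have upper (r : R) n : 0 < r < 1 -> (0 < n)%N -> saw_root R v n <=
    (3 * expR (40 / (1 - r)) ^+ 2 * (mu / r) ^+ 3) `^ n%:R^-1 * (mu / r).
  move=> r01 n0; have /andP[r0 _] := r01.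
  have mr : 0 < mu / r by rewrite divr_gt0.
  rewrite -[X in _ <= _ * X](root n) ?(ltW mr) //.
  have C0 : 0 <= 3 * expR (40 / (1 - r)) ^+ 2 :> R.
    by rewrite mulr_ge0 ?exprn_ge0 ?expR_ge0.
  rewrite -powRM ?exprn_ge0 ?(mulr_ge0 C0) ?exprn_ge0 ?(ltW mr) //.
  apply: root_le; first exact: ler0n.
  have := saws_upper_crit v n x01 r01 hx.
  have -> : r * mu^-1 = (mu / r)^-1 by rewrite invf_div.
  rewrite exprVn ler_pdivrMr ?exprn_gt0 // saw_countE.
  by rewrite addnC exprD mulrA.
apply/cvgrPdist_lt => e e0.
have low_cvg : (fun n : nat => mu * (mu^-1 `^ n%:R^-1)) @ \oo --> mu.
  rewrite -[X in _ --> X]mulr1; apply: cvgMr; apply: cvg_root.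
  by rewrite invr_gt0.
(* The upper bound tends to mu / r, which this choice makes equal to mu + e / 2. *)
pose r := mu / (mu + e / 2).
have r01 : 0 < r < 1.
  by apply/andP; split; rewrite /r ?divr_gt0 ?ltr_pdivrMr //; lra.
have mur : mu / r = mu + e / 2 by rewrite /r invf_div mulrC divfK // gt_eqF.
set C := 3 * expR (40 / (1 - r)) ^+ 2 * (mu / r) ^+ 3.
have C0 : 0 < C.
  by rewrite /C mur !mulr_gt0 ?exprn_gt0 ?expR_gt0 //; lra.
have up_cvg : (fun n : nat => C `^ n%:R^-1 * (mu / r)) @ \oo --> mu + e / 2.
  rewrite -[X in _ --> X]mul1r mur; apply: cvgMl; exact: cvg_root.
near=> n.
have n0 : (0 < n)%N by near: n; exists 1%N.
have h1 : mu - e < mu * (mu^-1 `^ n%:R^-1).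
  by near: n; apply: (cvgr_gt mu) => //; lra.
have h2 : C `^ n%:R^-1 * (mu / r) < mu + e.
  by near: n; apply: (cvgr_lt (mu + e / 2)) => //; lra.
have := lower n n0; have := upper r n r01 n0; rewrite -/C => h3 h4.
by rewrite distrC ltr_norml; apply/andP; split; lra.
Unshelve. all: by end_near.
Qed.

End Limit.

Theorem theorem1p2 (R : realType) (v : hexv) :
  cvgn (saw_root R v) /\
  connective_constant R v = Num.sqrt (2 + Num.sqrt 2).
Proof.
have h := @saw_root_cvg R v; split; first by apply/cvg_ex; eexists; exact: h.
exact: cvg_lim h.
Qed.
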